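(* Let $N\ge3$, $1<p<N$, and let $A,V,K$ satisfy hypotheses $(\mathbf A)$, $(\mathbf V)$, $(\mathbf K)$ (see context). Assume that there exists $R_1>0$ such that $V(r)<+\infty$ for almost every $r\in(0,R_1)$ and $$\operatorname*{ess\,sup}_{r\in(0,R_1)}\frac{K(r)}{r^{\alpha_0}V(r)^{\beta_0}}<+\infty\quad\text{for some }0\le\beta_0\le1\text{ and }\alpha_0>\alpha^*(a_0,\beta_0).$$ Then $\lim_{R\to0^+}\mathcal S_0(q_1,R)=0$ for every $q_1\in\mathbb R$ such that $$\max\{1,p\beta_0\}<q_1<q^*(a_0,\alpha_0,\beta_0).$$
   Context: Notation: $\mathbb R_+=(0,+\infty)$, $B_R=\{x\in\mathbb R^N:|x|<R\}$. Hypotheses: $(\mathbf A)$ $A:\mathbb R_+\to\mathbb R_+$ is continuous and there exist real numbers $a_0,a_\infty\in(p-N,p]$ and $c_0,c_\infty>0$ such that $c_0\le\liminf_{r\to0^+}A(r)/r^{a_0}\le\limsup_{r\to0^+}A(r)/r^{a_0}<+\infty$ and $c_\infty\le\liminf_{r\to+\infty}A(r)/r^{a_\infty}\le\limsup_{r\to+\infty}A(r)/r^{a_\infty}<+\infty$. $(\mathbf V)$ $V:\mathbb R_+\to[0,+\infty)$ is measurable and $V\in L^1_{\mathrm{loc}}(\mathbb R_+)$. $(\mathbf K)$ $K:\mathbb R_+\to\mathbb R_+$ is measurable and $K\in L^s_{\mathrm{loc}}(\mathbb R_+)$ for some $s>1$. Spaces: $S_A$ is the space of radial $u\in C_c^\infty(\mathbb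 R^N)$ with $\int_{\mathbb R^N}A(|x|)|\nabla u|^p\,dx<+\infty$, with norm $\|u\|_A=\left(\int_{\mathbb R^N}A(|x|)|\nabla u|^p\,dx\right)^{1/p}$. $D_A$ is the completion of $S_A$ with respect to $\|\cdot\|_A$; its elements are identified with radial functions on $\mathbb R^N\setminus\{0\}$ (weakly differentiable there, and with $\|u\|_A$ given by the same formula). $X:=D_A\cap L^p(\mathbb R^N,V(|x|)dx)$ with norm $\|u\|=\left(\|u\|_A^p+\int_{\mathbb R^N}V(|x|)|u|^p\,dx\right)^{1/p}$. For $R>0$, $q>1$: $\mathcal S_0(q,R):=\sup_{u\in X,\,\|u\|=1}\int_{B_R}K(|x|)|u|^q\,dx\in[0,+\infty]$. For $\alpha\in\mathbb R$, $\beta\in[0,1]$, $a>p-N$: $$\alpha^*(a,\beta):=\max\left\{p\beta-1-\tfrac{p-1}{p}N-a\beta+\tfrac ap,\ -(1-\beta)N\right\},\qquad q^*(a,\alpha,\beta):=p\,\frac{\alpha-p\beta+N+a\beta}{N-p+a}.$$ Convention: $V(r)^0=1$ for every $r$, even if $V(r)=0$; if $\beta_0>0$ and $V(r)=0$, the quotient $K(r)/(r^{\alpha_0}V(r)^{\beta_0})$ is understood as $+\infty$. *)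

(* Defs.v *)
From HB Require Import structures.
From mathcomp Require Import all_boot all_order all_algebra.
From mathcomp Require Import all_classical all_reals all_analysis.
Set Implicit Arguments.
Unset Strict Implicit.
Unset Printing Implicit Defensive.
Import Order.TTheory GRing.Theory Num.Theory.
Import numFieldNormedType.Exports.
Local Open Scope classical_set_scope.
Local Open Scope ring_scope.

(* Points of R^N are row vectors 'rV[R]_N.  The norm that 'rV[R]_N carries in
   the library is the sup norm; it is used only through its topology. *)
Section euclidean.
Context {R : realType} {N : nat}.
Implicit Types (x : 'rV[R]_N) (f : 'rV[R]_N -> R).

Definition enorm x : R := Num.sqrt (\sum_(i < N) x 0 i ^+ 2).

Definition eball (rho : R) : set 'rV[R]_N := [set x | enorm x < rho].

Definition radial f := forall x y, enorm x = enorm y -> f x = f y.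

Definition partial (i : 'I_N) f : 'rV[R]_N -> R := fun x => 'D_('e_i) f x.

Definition gradient f : 'rV[R]_N -> 'rV[R]_N := fun x => \row_i partial i f x.

Fixpoint iter_partial (s : seq 'I_N) f : 'rV[R]_N -> R :=
  if s is i :: s' then partial i (iter_partial s' f) else f.

Definition smooth f := forall s : seq 'I_N,
  continuous (iter_partial s f) /\
  forall i x, derivable (iter_partial s f) x 'e_i.

Definition supp f : set 'rV[R]_N := closure [set x | f x != 0].

Definition Cc_infty (Omega : set 'rV[R]_N) f :=
  [/\ smooth f, compact (supp f) & supp f `<=` Omega].

End euclidean.

(* N-dimensional Lebesgue measure: the Caratheodory measure of the outer measure
   obtained from countable coverings by boxes.  Its sigma-algebra is that of
   Lebesgue measurable sets. *)
Section lebesgue_RN.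
Context {R : realType} {N : nat}.
Local Open Scope ereal_scope.

(* [None] is the empty cell, so that finite coverings are allowed; without it
   the outer measure of set0 would not be 0 when N = 0. *)
Local Notation cell := (option ('rV[R]_N * 'rV[R]_N)%type).

Definition cell_set (c : cell) : set 'rV[R]_N :=
  if c is Some (a, b) then
    [set x | forall i, (a 0%R i < x 0%R i <= b 0%R i)%R]
  else set0.

Definition cell_vol (c : cell) : \bar R :=
  if c is Some (a, b) then
    (\prod_(i < N) Num.max 0 (b 0 i - a 0 i))%R%:E
  else 0.

Definition lebesgue_outer (E : set 'rV[R]_N) : \bar R :=
  ereal_inf [set \sum_(k <oo) cell_vol (F k) |
    F in [set F : nat -> cell | E `<=` \bigcup_k cell_set (F k)]].

Lemma cell_vol_ge0 c : 0 <= cell_vol c.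
Proof.
case: c => [[a b]|] //=; rewrite lee_fin prodr_ge0// => i _.
by rewrite le_max lexx.
Qed.

Lemma lebesgue_outer_ge0 E : 0 <= lebesgue_outer E.
Proof.
apply: le_ereal_inf_tmp => _ [F _ <-].
by apply: nneseries_ge0 => k _ _; exact: cell_vol_ge0.
Qed.

Lemma lebesgue_outer0 : lebesgue_outer set0 = 0.
Proof.
apply/eqP; rewrite eq_le lebesgue_outer_ge0 andbT.
apply: ereal_inf_lbound; exists (fun=> None); first exact: sub0set.
exact: eseries0.
Qed.

Lemma le_lebesgue_outer :
  {homo lebesgue_outer : A B / A `<=` B >-> A <= B}.
Proof.
move=> A B AB; apply/ereal_inf_le_tmp => x [F BF <-{x}].
by exists F => //; exact: subset_trans BF.
Qed.

Lemma lebesgue_outer_sigma_subadditive : sigma_subadditive lebesgue_outer.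
Proof.
move=> A.
have [[i ioo]|] := pselect (exists i, lebesgue_outer (A i) = +oo).
  rewrite (eseries_pinfty _ _ ioo) ?leey// => n _.
  by rewrite -ltNye (lt_le_trans _ (lebesgue_outer_ge0 _)).
rewrite -forallNE => Aoo.
suff add2e (e : {posnum R}) : lebesgue_outer (\bigcup_n A n) <=
    \sum_(i <oo) lebesgue_outer (A i) + e%:num%:E.
  by apply/lee_addgt0Pr => _/posnumP[].
rewrite (le_trans _ (epsilon_trick _ _ _))//; last first.
  by move=> n; exact: lebesgue_outer_ge0.
pose P n (F : nat -> cell) := A n `<=` \bigcup_k cell_set (F k) /\
  \sum_(k <oo) cell_vol (F k) <=
    lebesgue_outer (A n) + (e%:num / (2 ^ n.+1)%:R)%:E.
have [G PG] : {G : nat -> nat -> cell & forall n, P n (G n)}.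
  apply: (@choice _ _ P) => n; rewrite /P /lebesgue_outer.
  set S := (X in ereal_inf X); move infS : (ereal_inf S) => iS.
  case: iS infS => [r Sr|Soo|Soo].
  - have en1 : (0 < e%:num / (2 ^ n.+1)%:R)%R by [].
    have /(lb_ereal_inf_adherent en1) : ereal_inf S \is a fin_num by rewrite Sr.
    move=> [x [B AnB muBx] xS].
    by exists B; split => //; rewrite muBx -Sr; exact/ltW.
  - by have := Aoo n; rewrite /lebesgue_outer Soo.
  - suff : lbound S 0 by move/le_ereal_inf_tmp; rewrite Soo.
    move=> /= _ [B AnB <-].
    by apply: nneseries_ge0 => k _ _; exact: cell_vol_ge0.
have G0 x : 0 <= (cell_vol \o uncurry G) x by exact: cell_vol_ge0.
apply: (@le_trans _ _ (\esum_(i in setT) (cell_vol \o uncurry G) i)).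
  apply: ereal_inf_lbound => /=.
  have /card_esym/ppcard_eqP[f] := card_nat2.
  exists (uncurry G \o f).
    move=> t [i _ /(PG i).1[j _ Gijt]].
    by exists (f^-1%FUN (i, j)) => //=; rewrite invK ?inE.
  rewrite -(esum_pred_image (cell_vol \o uncurry G) _ xpredT) ?[fun=> _]set_true//.
  by rewrite image_eq.
rewrite (_ : esum _ _ = \sum_(i <oo) \sum_(j <oo) cell_vol (G i j)); last first.
  pose J : nat -> set (nat * nat) := fun i => [set (i, j) | j in setT].
  rewrite (_ : setT = \bigcup_k J k); last first.
    by rewrite predeqE => -[a b]; split => // _; exists a => //; exists b.
  rewrite esum_bigcupT /=; last 2 first.
    - apply/trivIsetP => i j _ _ ij.
      rewrite predeqE => -[n m] /=; split => //= -[] [_] _ [<-{n} _].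
      by move=> [m' _] [] /esym/eqP; rewrite (negbTE ij).
    - by move=> /= [n m]; exact: G0.
  rewrite -(image_id [set: nat]) -fun_true esum_pred_image//; last first.
    by move=> n _; apply: esum_ge0 => m _; exact: cell_vol_ge0.
  apply: eq_eseriesr => /= j _.
  rewrite -(esum_pred_image (cell_vol \o uncurry G) (pair j) predT)//=; last 2 first.
    by move=> n _; exact: cell_vol_ge0.
    by move=> ? ? _ _; exact: (@can_inj _ _ _ snd).
  by congr esum; rewrite predeqE => -[a b]; split; move=> [i _ <-]; exists i.
apply: lee_nneseries => [n _ _|n _]; last exact: (PG n).2.
by apply: nneseries_ge0 => m _ _; exact: cell_vol_ge0.
Qed.

HB.instance Definition _ := isOuterMeasure.Build R 'rV[R]_N lebesgue_outer
  lebesgue_outer0 lebesgue_outer_ge0 le_lebesgue_outer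
  lebesgue_outer_sigma_subadditive.

End lebesgue_RN.

Section lebesgueN.
Context {R : realType} {N : nat}.

Definition RN : measurableType _ := caratheodory_type (@lebesgue_outer R N).

Definition lebesgueN : set RN -> \bar R := @lebesgue_outer R N.

Let lebesgueN0 : lebesgueN set0 = 0%E.
Proof. exact: lebesgue_outer0. Qed.

Let lebesgueN_ge0 A : (0 <= lebesgueN A)%E.
Proof. exact: lebesgue_outer_ge0. Qed.

Let lebesgueN_semi_sigma_additive : semi_sigma_additive lebesgueN.
Proof. by move=> F mF tF mUF; exact: caratheodory_measure_sigma_additive. Qed.

HB.instance Definition _ := isMeasure.Build _ _ _ lebesgueN
  lebesgueN0 lebesgueN_ge0 lebesgueN_semi_sigma_additive.

End lebesgueN.

Section function_spaces.
Context {R : realType} {N : nat}.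
Local Notation mu := (@lebesgueN R N).
Implicit Types (A V K : R -> R) (u : 'rV[R]_N -> R).
Implicit Types (g : 'rV[R]_N -> 'rV[R]_N) (p q rho : R).
Local Open Scope ereal_scope.

Definition punctured : set 'rV[R]_N := ~` [set 0%R].

Definition L1loc_on (Omega : set 'rV[R]_N) u :=
  forall C : set 'rV[R]_N, compact C -> C `<=` Omega ->
    mu.-integrable C (fun x => (u x)%:E).

Definition is_weak_gradient (Omega : set 'rV[R]_N) u g :=
  [/\ L1loc_on Omega u,
      forall i, L1loc_on Omega (fun x => g x 0%R i) &
      forall phi, Cc_infty Omega phi -> forall i,
        \int[mu]_x (u x * partial i phi x)%:E =
        - \int[mu]_x (g x 0%R i * phi x)%:E].

(* The p-th power of ||u||_A when g is the gradient of u; the value of A at 0 is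
   irrelevant, as is that of V and K below. *)
Definition energy p A g : \bar R :=
  \int[mu]_x (A (enorm x) * enorm (g x) `^ p)%:E.

Definition S_A p A u :=
  [/\ Cc_infty setT u, radial u & energy p A (gradient u) < +oo].

(* [D_A p A u g]: u belongs to D_A and g is its weak gradient on R^N \ {0}.  An
   element of the completion is the class of a Cauchy sequence of S_A; by the
   pointwise estimates for radial functions such a sequence converges off the
   origin, and its class is identified with the limit u.  The gradients then
   converge to that of u in the norm of the completion.  Carrying g along
   determines it only a.e., which is all that the norms below see. *)
Definition D_A p A u g :=
  [/\ radial u, is_weak_gradient punctured u g &
      exists u_ : nat -> 'rV[R]_N -> R,
        [/\ forall n, S_A p A (u_ n),
            energy p A (fun x => gradient (u_ n) x - g x)%R @[n --> \oo] --> 0 &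
            {ae mu, forall x, u_ n x @[n --> \oo] --> u x}]].

Definition potential p V u : \bar R :=
  \int[mu]_x (V (enorm x) * `|u x| `^ p)%:E.

Definition X p A V u g := D_A p A u g /\ potential p V u < +oo.

Definition X_norm p A V u g : \bar R :=
  (energy p A g + potential p V u) `^ p^-1.

Definition S_0 p A V K q rho : \bar R :=
  ereal_sup [set \int[mu]_(x in eball rho) (K (enorm x) * `|ug.1 x| `^ q)%:E |
    ug in [set ug | X p A V ug.1 ug.2 /\ X_norm p A V ug.1 ug.2 = 1]].

End function_spaces.

Section hypotheses.
Context {R : realType}.
Local Notation mu := (@completed_lebesgue_measure R).
Implicit Types (A V K : R -> R) (p s a : R).

Definition Lloc_pos s (f : R -> R) :=
  measurable_fun (`]0, +oo[ : set (caratheodory_type (wlength idfun)^*%mu)) f /\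
  forall C : set R, compact C -> C `<=` `]0, +oo[ ->
    (\int[mu]_(r in C) (`|f r| `^ s)%:E < +oo)%E.

Definition hyp_A (N : nat) p A (a0 aoo c0 coo : R) :=
  let A0 r := (A r / r `^ a0)%:E in
  let Aoo r := (A r / r `^ aoo)%:E in
  [/\ forall r, 0 < r -> 0 < A r /\ {for r, continuous A},
      p - N%:R < a0 <= p /\ p - N%:R < aoo <= p,
      0 < c0 /\ 0 < coo,
      [/\ (c0%:E <= limf_einf A0 0^'+)%E,
          (limf_einf A0 0^'+ <= limf_esup A0 0^'+)%E &
          (limf_esup A0 0^'+ < +oo)%E] &
      [/\ (coo%:E <= limf_einf Aoo +oo%R)%E,
          (limf_einf Aoo +oo%R <= limf_esup Aoo +oo%R)%E &
          (limf_esup Aoo +oo%R < +oo)%E]].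

Definition hyp_V V := (forall r, 0 < r -> 0 <= V r) /\ Lloc_pos 1 V.

Definition hyp_K K :=
  (forall r, 0 < r -> 0 < K r) /\ exists2 s, 1 < s & Lloc_pos s K.

(* Here 0 `^ 0 = 1, so V(r)^0 = 1 also when V(r) = 0.  The quotient is
   nonnegative on R_+, so its essential supremum over an interval of R_+ is that
   of its extension by 0 outside the interval. *)
Definition KV_ratio K V (alpha beta r : R) : \bar R :=
  if (0 < beta) && (V r == 0) then +oo%E
  else (K r / (r `^ alpha * V r `^ beta))%:E.

Definition alpha_star (N : nat) p a beta : R :=
  Num.max (p * beta - 1 - (p - 1) / p * N%:R - a * beta + a / p)
          (- ((1 - beta) * N%:R)).

Definition q_star (N : nat) p a alpha beta : R :=
  p * ((alpha - p * beta + N%:R + a * beta) / (N%:R - p + a)).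

End hypotheses.

(* Main.v *)
(** Put nu = (N - p + a0) / p.  By Young's inequality the oscillation of a radial
    function between two spheres is controlled by its energy and by the lower
    bounds on A, so that a function of bounded energy satisfies
    |u(x)| <= C |x|^(-nu) for |x| <= 1.  Since q1 > p beta0, the hypothesis on
    K / (r^alpha0 V^beta0) then gives, by interpolation,
      K |u|^q1 <= C r^delta (V |u|^p + r^tau)
    with delta > 0 and tau > -N, which is possible because q1 < q^*.  Integrating
    over B_R with ||u|| = 1 yields S_0(q1, R) <= C R^delta.

    For the lower bound S_0 >= 0 the unit sphere of X must not be empty (the
    supremum of the empty set is -oo): it contains a multiple of a smooth bump
    supported in an annulus.  Such a bump has positive energy, because all its
    multiples would otherwise obey one and the same pointwise bound. *)
Require Import Defs.
From HB Require Import structures.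
From mathcomp Require Import all_boot all_order all_algebra.
From mathcomp Require Import all_classical all_reals all_analysis.
From mathcomp Require Import ess_sup_inf measurable_realfun.
From mathcomp Require Import ring lra.
Import Order.TTheory GRing.Theory Num.Theory.
Import numFieldNormedType.Exports.
Set Implicit Arguments.
Unset Strict Implicit.
Unset Printing Implicit Defensive.
Local Open Scope classical_set_scope.
Local Open Scope ring_scope.

(** * Lebesgue measure on R^N *)

(** The measure is known only through coverings by boxes, and polar coordinates are never set up.
    Scaling of coverings gives balls the volume omega r^N, and two consequences do the work of polar
    coordinates. The integral of a continuous radial F over rho < |x| <= r is differentiable in r,
    with derivative omega N r^(N-1) F(r); the oscillation estimate thus becomes a monotonicity
    argument in one variable. And on bounded shells the preimage under the norm of a set E of radii
    has measure at most a constant times that of E; this carries null sets, Lebesgue measurability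
    and local integrability from the half-line to R^N. Young's inequality makes the pointwise bound
    additive, hence inhomogeneous, in the energy. This is harmless on the unit sphere of X, where
    one bound on the energy serves all u. The condition q1 < [q_star] says that the borderline
    choice tau = -N would leave a positive exponent delta; making |x|^tau integrable at 0 then costs
    only part of it. *)

Section cells.
Context {R : realType} {N : nat}.
Local Notation cell := (option ('rV[R]_N * 'rV[R]_N)%type).
Local Notation lout := (@lebesgue_outer R N).
Local Open Scope ereal_scope.

Lemma lebesgue_outer_le_cover (E : set 'rV[R]_N) (F : nat -> cell) :
  E `<=` \bigcup_k cell_set (F k) -> lout E <= \sum_(k <oo) cell_vol (F k).
Proof. by move=> EF; apply: ereal_inf_lbound; exists F. Qed.

Lemma lebesgue_outer_le_cell (E : set 'rV[R]_N) (a b : 'rV[R]_N) :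
  E `<=` cell_set (Some (a, b)) ->
  lout E <= (\prod_(i < N) Num.max 0 (b 0 i - a 0 i))%R%:E.
Proof.
move=> Eab.
pose F k : cell := if k is 0%N then Some (a, b) else None.
apply: (le_trans (@lebesgue_outer_le_cover _ F _)).
  by move=> x /Eab ?; exists 0%N.
rewrite (nneseries_split 0 1) => [|k _]; last exact: cell_vol_ge0.
rewrite add0n big_nat1 eseries0 ?adde0//.
by move=> [|k].
Qed.

(** The hyperplane x_i = c cuts every half-open cell into two half-open cells whose volumes add up,
    so a covering of X splits into coverings of its two parts. When c lies outside the cell, one
    piece is inverted and [Num.max 0] gives it volume 0. *)
Lemma half_space_caratheodory (i : 'I_N) (c : R) :
  lout.-caratheodory [set x | (x 0 i <= c)%R].
Proof.
apply: le_caratheodory_measurable => X.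
apply: le_ereal_inf_tmp => _ [F XF <-].
pose lo (d : cell) : cell := if d is Some (a, b) then
  Some (a, \row_j (if j == i then Num.min (b 0 j) c else b 0 j)%R) else None.
pose hi (d : cell) : cell := if d is Some (a, b) then
  Some (\row_j (if j == i then Num.max (a 0 j) c else a 0 j)%R, b) else None.
have vol d : cell_vol d = cell_vol (lo d) + cell_vol (hi d).
  case: d => [[a b]|] /=; last by rewrite adde0.
  rewrite -EFinD; congr EFin.
  rewrite (bigD1 i)//= [X in (_ = X + _)%R](bigD1 i)//=.
  rewrite [X in (_ = _ + X)%R](bigD1 i)//= !mxE eqxx.
  rewrite (eq_bigr (fun j => Num.max 0 (b 0 j - a 0 j))%R
    (P := fun j => j != i)
    (F1 := fun j => Num.max 0 ((\row_j0 (if j0 == i then Num.min (b 0 j0) c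
       else b 0 j0)) 0 j - a 0 j))%R); last first.
    by move=> j /negPf ji; rewrite !mxE ji.
  rewrite [X in (_ = _ + _ * X)%R](eq_bigr (fun j => Num.max 0 (b 0 j - a 0 j)))%R;
    last by move=> j /negPf ji; rewrite !mxE ji.
  rewrite -mulrDl; congr (_ * _)%R.
  rewrite /Num.max /Num.min.
  by repeat case: ifPn; rewrite ?ltNge ?negbK; lra.
under eq_eseriesr do rewrite vol.
rewrite nneseriesD; [|by move=> *; exact: cell_vol_ge0..].
apply: leeD; apply: lebesgue_outer_le_cover => x [/XF[k _ Fk] /= xc];
  exists k => //; case: (F k) Fk => [[a b]|]//= H j; have := H j;
  rewrite !mxE; case: eqP => // -> /andP[h1 h2].
- by rewrite h1 le_min h2 xc.
- by rewrite h2 andbT gt_max h1/= ltNge; apply/negP.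
Qed.

Lemma lebesgue_outer_affine_le (t : R) (h : 'rV[R]_N) (E : set 'rV[R]_N) :
  (0 < t)%R -> (t ^+ N)%:E * lout ((fun x => t *: x + h)%R @^-1` E) <= lout E.
Proof.
move=> t0; apply: le_ereal_inf_tmp => _ [F EF <-].
pose g (d : cell) : cell := if d is Some (a, b) then
  Some (t^-1 *: (a - h), t^-1 *: (b - h))%R else None.
have vol d : cell_vol d = (t ^+ N)%:E * cell_vol (g d).
  case: d => [[a b]|] /=; last by rewrite mule0.
  rewrite -EFinM; congr EFin.
  rewrite -[X in (_ ^+ X)%R]card_ord -prodr_const -big_split/=.
  apply: eq_bigr => i _; rewrite !mxE maxr_pMr ?ltW// mulr0; congr Num.max.
  by field; rewrite gt_eqF.
under eq_eseriesr do rewrite vol.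
rewrite nneseriesZl => [|k _]; last exact: cell_vol_ge0.
rewrite lee_pmul2l// ?lte_fin ?exprn_gt0//.
apply: lebesgue_outer_le_cover => x /= /EF[k _ Fk]; exists k => //.
case: (F k) Fk => [[a b]|]//= H j; have := H j; rewrite !mxE.
by rewrite ltr_pdivrMl// ler_pdivlMl//; lra.
Qed.

(** The reverse inequality is the same bound for the inverse map. With h = 0 this yields the volume
    of balls, with t = 1 translation invariance. *)
Lemma lebesgue_outer_affine (t : R) (h : 'rV[R]_N) (E : set 'rV[R]_N) :
  (0 < t)%R -> (t ^+ N)%:E * lout ((fun x => t *: x + h)%R @^-1` E) = lout E.
Proof.
move=> t0; apply/eqP; rewrite eq_le lebesgue_outer_affine_le//=.
have ti0 : (0 < t^-1)%R by rewrite invr_gt0.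
have := @lebesgue_outer_affine_le t^-1 (- (t^-1 *: h))%R
  ((fun x => t *: x + h)%R @^-1` E) ti0.
rewrite -comp_preimage (_ : _ \o _ = id); last first.
  apply/funext => x /=; rewrite scalerBr !scalerA divff ?gt_eqF// !scale1r.
  by rewrite subrK.
rewrite preimage_id => H.
rewrite -(@lee_pmul2l _ (t^-1 ^+ N)%:E)// ?lte_fin ?exprn_gt0//.
by rewrite muleA -EFinM -exprMn mulVf ?gt_eqF// expr1n mul1e.
Qed.

End cells.

(** * The volume of the unit cube *)

Section cube.
Context {R : realType}.
Local Open Scope ereal_scope.

(* Induction on the dimension, integrating out one coordinate; the weights c k
   carry the lengths of the sides already integrated. *)
Lemma box_cover_volume (n : nat) (c : nat -> R) (a b : nat -> 'I_n -> R) :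
  (forall k, 0 <= c k)%R ->
  (forall x : 'I_n -> R, (forall i, 0 < x i <= 1)%R ->
    1 <= \sum_(k <oo) (c k * \prod_(i < n) \1_(`]a k i, b k i]) (x i))%:E) ->
  1 <= \sum_(k <oo) (c k * \prod_(i < n) Num.max 0 (b k i - a k i))%:E.
Proof.
elim: n c a b => [|n IH] c a b c0 H.
  have := H (fun=> 1%R) (fun i => ltac:(by case: i)).
  by under eq_eseriesr do rewrite big_ord0;
    under [in X in _ -> X]eq_eseriesr do rewrite big_ord0.
pose L k : R := (\prod_(i < n) Num.max 0 (b k (lift ord0 i) - a k (lift ord0 i)))%R.
have L0 k : (0 <= L k)%R by apply: prodr_ge0 => i _; rewrite le_max lexx.
(* The slice of the cube at height t is covered by the cells whose first side contains t: the
   induction hypothesis applies with that indicator absorbed in the weights. Integrating over t in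
   ]0, 1] then bounds the indicator by the length of the side. *)
have Ht (t : R) : (t \in `]0%R, 1%R]) ->
    1 <= \sum_(k <oo) (c k * L k * \1_(`]a k ord0, b k ord0]) t)%:E.
  rewrite in_itv/= => t01.
  under eq_eseriesr do rewrite mulrAC.
  apply: (IH (fun k => c k * \1_(`]a k ord0, b k ord0]) t)%R
    (fun k i => a k (lift ord0 i)) (fun k i => b k (lift ord0 i))).
    by move=> k; rewrite mulr_ge0.
  move=> x x01.
  pose y (i : 'I_n.+1) := if unlift ord0 i is Some j then x j else t.
  have y0 : y ord0 = t by rewrite /y unlift_none.
  have yl i : y (lift ord0 i) = x i by rewrite /y liftK.
  apply: (le_trans (H y _)).
    by move=> i; rewrite /y; case: unliftP.
  under eq_eseriesr do rewrite big_ord_recl y0 mulrA.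
  apply: lee_nneseries => [k _|k _].
    by rewrite lee_fin mulr_ge0 ?mulr_ge0 ?prodr_ge0.
  by rewrite lee_fin; under eq_bigr do rewrite yl.
have : \int[@lebesgue_measure R]_(t in `]0%R, 1%R]) (cst 1 t) <=
    \int[@lebesgue_measure R]_(t in `]0%R, 1%R])
      (\sum_(k <oo) (c k * L k * \1_(`]a k ord0, b k ord0]) t)%:E).
  apply: ge0_le_integral => //.
    apply: ge0_emeasurable_sum => [k t _ _|k _].
      by rewrite lee_fin !mulr_ge0.
    by apply/measurable_EFinP/measurable_funM.
  rewrite integral_cst//= mul1e lebesgue_measure_itv/= lte_fin ltr01 oppr0 adde0.
move/le_trans; apply.
rewrite integral_nneseries//; last first.
- by move=> k t _; rewrite lee_fin !mulr_ge0.
- by move=> k; apply/measurable_EFinP/measurable_funM.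
apply: lee_nneseries => [k _ _|k _].
  by apply: integral_ge0 => t _; rewrite lee_fin !mulr_ge0.
under eq_integral do rewrite EFinM.
rewrite ge0_integralZl//; last 2 first.
- by apply/measurable_EFinP; exact: measurable_indic.
- by rewrite lee_fin mulr_ge0.
rewrite integral_indic//= big_ord_recl -/(L k).
rewrite (mulrCA (c k)) (mulrC _ (c k * L k)%R) [leRHS]EFinM.
apply: lee_wpmul2l; first by rewrite lee_fin mulr_ge0.
apply: (@le_trans _ _ (lebesgue_measure (`]a k ord0, b k ord0]%classic : set R))).
  by apply: le_measure; rewrite ?inE//; exact: measurableI.
rewrite lebesgue_measure_itv/= lte_fin; case: ifPn => ab.
  by rewrite -EFinD lee_fin le_max lexx orbT.
by rewrite lee_fin le_max lexx.
Qed.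

(** The lower bound that keeps the outer measure from degenerating; it makes [omega] positive. *)
Lemma lebesgue_outer_unit_cube (N : nat) :
  1 <= @lebesgue_outer R N [set x | forall i, (0 < x 0 i <= 1)%R].
Proof.
apply: le_ereal_inf_tmp => _ [F EF <-].
(* Empty cells get weight 0: for N = 0 their empty product would be 1. *)
pose c k : R := if F k is Some _ then 1%R else 0%R.
pose a k (i : 'I_N) : R := if F k is Some (a, b) then a 0%R i else 0%R.
pose b k (i : 'I_N) : R := if F k is Some (a, b) then b 0%R i else 0%R.
have -> : \sum_(k <oo) cell_vol (F k) =
    \sum_(k <oo) (c k * \prod_(i < N) Num.max 0 (b k i - a k i))%:E.
  apply: eq_eseriesr => k _; rewrite /c /a /b.
  by case: (F k) => [[u v]|]/=; rewrite ?mul1r ?mul0r.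
apply: box_cover_volume => [k|x x01].
  by rewrite /c; case: (F k).
have [|k _ Fk] := EF (\row_i x i).
  by move=> i; rewrite mxE.
have E : (c k * \prod_(i < N) \1_(`]a k i, b k i]) (x i))%R = 1%R.
  move: Fk; rewrite /c /a /b; case: (F k) => [[u v]|]//= H.
  rewrite mul1r big1// => i _; rewrite indicE mem_set//=.
  by have := H i; rewrite mxE in_itv.
rewrite (@nneseriesD1 _ _ k) ?E//; last first.
  move=> n _; rewrite lee_fin mulr_ge0 ?prodr_ge0//.
  by rewrite /c; case: (F n).
rewrite leeDl//; apply: nneseries_ge0 => n _ _; rewrite lee_fin mulr_ge0 ?prodr_ge0//.
by rewrite /c; case: (F n).
Qed.

End cube.

(** * Borel sets and continuous functions *)

Section measurability.
Context {R : realType} {N : nat}.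
Local Notation RN := (@RN R N).

Lemma coord_measurable (i : 'I_N) :
  measurable_fun [set: RN] (fun x : RN => x 0 i).
Proof.
move=> mD; apply: (measurability _ (RGenOInfty.measurableE R)) => //.
move=> /= _ [_ [c ->] <-]; rewrite setTI.
rewrite (_ : _ @^-1` _ = ~` [set x : RN | x 0 i <= c]).
  by apply: measurableC; exact: half_space_caratheodory.
by apply/seteqP; split=> x /=; rewrite in_itv/= andbT ltNge => /negP.
Qed.

(** U is the union of the cubes with rational centre and radius 1/(n + 1) that it contains, a
    countable family. *)
Lemma open_measurable_RN (U : set 'rV[R]_N) : open U -> measurable (U : set RN).
Proof.
move=> oU.
pose box (q : 'rV[rat]_N * nat) : set RN :=
  [set x | forall i, x 0 i \in `]ratr (q.1 0 i) - q.2.+1%:R^-1,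
                                 ratr (q.1 0 i) + q.2.+1%:R^-1[].
have mbox q : measurable (box q).
  rewrite (_ : box q = \bigcap_(i in [set: 'I_N]) ((fun x : RN => x 0 i) @^-1`
      [set` `]ratr (q.1 0 i) - q.2.+1%:R^-1, ratr (q.1 0 i) + q.2.+1%:R^-1[])).
    apply: fin_bigcap_measurable; first exact: finite_finset.
    move=> i _; rewrite -[_ @^-1` _]setTI.
    exact: coord_measurable.
  by apply/seteqP; split=> x /= h i; [move=> _; exact: h|exact: (h i I)].
rewrite (_ : U = \bigcup_(q in [set q | box q `<=` U]) box q).
  rewrite bigcup_mkcond; apply: countable_bigcupT_measurable => [|q]; first exact: countableP.
  by case: ifPn.
apply/seteqP; split=> [x Ux|x [q qU]]; last exact: qU.
have /nbhs_ballP[e /= e0 xeU] : nbhs x U by exact: open_nbhs_nbhs.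
(* A cube of radius below e / 2 that contains x stays in the ball of radius e about x. *)
have [n ne] : exists n, n.+1%:R^-1 < e / 2.
  exists (Num.truncn (e / 2)^-1).
  rewrite invf_plt ?posrE ?divr_gt0//.
  exact: truncnS_gt.
have tri (a b c d s : R) : d < s / 2 -> a - d < b < a + d -> c - d < a < c + d ->
    - s < c - b < s.
  by move=> ? /andP[? ?] /andP[? ?]; apply/andP; split; lra.
have /choice[q qP] : forall i, exists q : rat,
    ratr q \in `]x 0 i - n.+1%:R^-1, x 0 i + n.+1%:R^-1[.
  move=> i; apply: rat_in_itvoo; rewrite ltrD2l gtrN//.
exists (\row_i q i, n).
  move=> y /= yq; apply: xeU; split=> // i j; rewrite ord1.
  have := qP j; have := yq j; rewrite !mxE/= !in_itv/= /ball/= ltr_norml.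
  by move: ne; exact: tri.
move=> i /=; have := qP i; rewrite !mxE !in_itv/= => /andP[? ?].
by apply/andP; split; [rewrite ltrBlDr|rewrite -ltrBlDr].
Qed.

Lemma closed_measurable_RN (U : set 'rV[R]_N) :
  closed U -> measurable (U : set RN).
Proof. by move=> /closed_openC/open_measurable_RN/measurableC; rewrite setCK. Qed.

Lemma compact_measurable_RN (U : set 'rV[R]_N) :
  compact U -> measurable (U : set RN).
Proof.
by move=> cU; apply: closed_measurable_RN; apply: compact_closed.
Qed.

Lemma continuous_measurable_RN (f : 'rV[R]_N -> R) :
  continuous f -> measurable_fun [set: RN] (f : RN -> R).
Proof.
move=> /continuousP cf mD; apply: (measurability _ (RGenOpens.measurableE R)) => //.
move=> _ [_ [a [b ->] <-]]; rewrite setTI.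
apply: open_measurable_RN; exact/cf/interval_open.
Qed.

End measurability.

Section enorm.
Context {R : realType} {N : nat}.
Implicit Types x y : 'rV[R]_N.

Lemma enorm_ge0 x : 0 <= enorm x. Proof. exact: sqrtr_ge0. Qed.

Lemma sqr_enorm x : enorm x ^+ 2 = \sum_(i < N) x 0 i ^+ 2.
Proof. by rewrite sqr_sqrtr// sumr_ge0// => i _; exact: sqr_ge0. Qed.

Lemma enorm_eq0 x : (enorm x == 0) = (x == 0).
Proof.
rewrite -sqrf_eq0 sqr_enorm psumr_eq0; last by move=> *; exact: sqr_ge0.
apply/idP/eqP => [/allP h|->]; last first.
  by apply/allP => i _; rewrite mxE expr0n/= eqxx.
apply/rowP => i; rewrite mxE; apply/eqP; rewrite -sqrf_eq0.
exact: (h i (mem_index_enum i)).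
Qed.

Lemma enorm0 : enorm (0 : 'rV[R]_N) = 0.
Proof. by apply/eqP; rewrite enorm_eq0. Qed.

Lemma enorm_gt0 x : (0 < enorm x) = (x != 0).
Proof. by rewrite lt_neqAle enorm_ge0 andbT eq_sym enorm_eq0. Qed.

Lemma enormZ (t : R) x : enorm (t *: x) = `|t| * enorm x.
Proof.
rewrite /enorm -sqrtr_sqr -sqrtrM ?sqr_ge0// mulr_sumr; congr Num.sqrt.
by apply: eq_bigr => i _; rewrite mxE exprMn.
Qed.

Lemma ler_coord_enorm x i : `|x 0 i| <= enorm x.
Proof.
rewrite -sqrtr_sqr ler_wsqrtr// (bigD1 i)//= lerDl.
by apply: sumr_ge0 => *; exact: sqr_ge0.
Qed.

Lemma ler_enorm_coord x (M : R) : 0 <= M -> (forall i, `|x 0 i| <= M) ->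
  enorm x <= N%:R * M.
Proof.
move=> M0 xM; rewrite -(@ger0_norm _ (N%:R * M)) ?mulr_ge0// -sqrtr_sqr.
rewrite ler_wsqrtr//.
apply: (@le_trans _ _ (\sum_(i < N) M ^+ 2)).
  apply: ler_sum => i _; by rewrite -real_normK ?num_real// ler_sqr ?nnegrE.
rewrite sumr_const card_ord -[leLHS]mulr_natl exprMn ler_pM ?sqr_ge0//.
clear; by case: N => [|n]; rewrite ?expr0n// -natrX ler_nat (leq_pexp2l (n1 := 1)).
Qed.

Lemma enorm_continuous : continuous (@enorm R N).
Proof.
move=> x; apply: (@continuous_comp _ _ _ (fun y : 'rV[R]_N => \sum_(i < N) y 0 i ^+ 2)
  Num.sqrt); last exact: sqrt_continuous.
apply: (continuous_big (op := +%R)) => [|i _ y]; first exact: add_continuous.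
apply: (@continuous_comp _ _ _ (fun y : 'rV[R]_N => y 0 i) (fun r => r ^+ 2)).
  exact: coord_continuous.
exact: exprn_continuous.
Qed.

Lemma enorm_measurable : measurable_fun [set: @RN R N] (@enorm R N : @RN R N -> R).
Proof. exact/continuous_measurable_RN/enorm_continuous. Qed.

End enorm.

(** * Balls, shells and sets of radii *)

Section balls.
Context {R : realType} {N : nat}.
Hypothesis N0 : (0 < N)%N.
Local Notation mu := (@lebesgueN R N).
Local Open Scope ereal_scope.

Definition cball (r : R) : set 'rV[R]_N := [set x | (enorm x <= r)%R].

Lemma measurable_cball r : measurable (cball r : set (@RN R N)).
Proof.
rewrite (_ : cball r = enorm @^-1` [set` `]-oo, r]]).
  by rewrite -[X in measurable X]setTI; exact: enorm_measurable.
by apply/seteqP; split=> x; rewrite /cball/= in_itv.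
Qed.

Lemma measurable_eball r : measurable (eball r : set (@RN R N)).
Proof.
rewrite (_ : eball r = enorm @^-1` [set` `]-oo, r[]).
  by rewrite -[X in measurable X]setTI; exact: enorm_measurable.
by apply/seteqP; split=> x; rewrite /eball/= in_itv.
Qed.

Lemma lebesgueN_le (A B : set 'rV[R]_N) : A `<=` B -> mu A <= mu B.
Proof. exact: le_lebesgue_outer. Qed.

Lemma lebesgueN_cball_lty r : mu (cball r) < +oo.
Proof.
apply: (@le_lt_trans _ _ (\prod_(i < N) Num.max 0
   ((\row_(j < N) (`|r| + 1)) 0 i - (\row_(j < N) (- (`|r| + 1))) 0 i))%R%:E).
  apply: lebesgue_outer_le_cell => x /= xr i.
  have := le_trans (ler_coord_enorm x i) (le_trans xr (ler_norm r)).
  rewrite !mxE ler_norml => /andP[? ?].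
  by apply/andP; split; lra.
exact: ltry.
Qed.

(** The volume of the unit ball; only its finiteness and positivity matter. *)
Definition omega : R := fine (mu (cball 1)).

Lemma omegaE : mu (cball 1) = omega%:E.
Proof. by rewrite fineK// ge0_fin_numE ?lebesgueN_cball_lty. Qed.

Lemma lebesgueN_cball_gt0 r : (0 < r)%R -> mu (cball r) = (omega * r ^+ N)%:E.
Proof.
move=> r0; rewrite EFinM -omegaE muleC /lebesgueN.
rewrite -(lebesgue_outer_affine 0 (cball r) r0); congr (_ * lebesgue_outer _).
apply/funext => x; apply/propext; rewrite /cball/= addr0 enormZ gtr0_norm//.
by rewrite -{2}(mulr1 r) ler_pM2l.
Qed.

Lemma omega_gt0 : (0 < omega)%R.
Proof.
have Np : (0 < N%:R :> R)%R by rewrite ltr0n.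
have /(le_trans (lebesgue_outer_unit_cube N)) :
   mu [set x | forall i, (0 < x 0 i <= 1)%R] <= mu (cball (N%:R * 1)).
  apply: lebesgueN_le => x /= x01; apply: ler_enorm_coord => // i.
  by have /andP[? ?] := x01 i; rewrite ger0_norm// ltW.
rewrite lebesgueN_cball_gt0 ?mulr1// lee_fin => h.
have : (0 < omega * N%:R ^+ N)%R by exact: lt_le_trans h.
by rewrite pmulr_lgt0// exprn_gt0.
Qed.

Lemma lebesgueN_set1_0 : mu [set 0%R] = 0.
Proof.
apply/eqP; rewrite eq_le measure_ge0 andbT.
apply/lee_addgt0Pr => e e0; rewrite add0e.
(* As t <= 1 and N > 0, the volume omega t^N is at most omega t <= e. *)
pose t := Num.min 1%R (e / omega)%R.
have t0 : (0 < t)%R by rewrite lt_min ltr01 divr_gt0// omega_gt0.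
apply: (@le_trans _ _ (mu (cball t))).
  by apply: lebesgueN_le => x ->; rewrite /cball/= enorm0 ltW.
rewrite lebesgueN_cball_gt0// lee_fin mulrC -ler_pdivlMr ?omega_gt0//.
apply: (@le_trans _ _ t); last by rewrite ge_min lexx orbT.
rewrite -{2}(expr1 t); apply: ler_wiXn2l => //; first exact: ltW.
by rewrite ge_min lexx.
Qed.

Lemma lebesgueN_cball r : (0 <= r)%R -> mu (cball r) = (omega * r ^+ N)%:E.
Proof.
rewrite le_eqVlt => /predU1P[<-|]; last exact: lebesgueN_cball_gt0.
rewrite expr0n gtn_eqF// mulr0.
transitivity (mu [set 0%R]); last exact: lebesgueN_set1_0.
congr (mu _).
apply/seteqP; split=> x; rewrite /cball/=; last by move=> ->; rewrite enorm0.
by move=> x0; apply/eqP; rewrite -enorm_eq0 eq_le x0 enorm_ge0.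
Qed.

Lemma lebesgueN_shell a b : (0 <= a <= b)%R ->
  mu [set x | (a < enorm x <= b)%R] = (omega * (b ^+ N - a ^+ N))%:E.
Proof.
move=> /andP[a0 ab].
rewrite (_ : [set x | _] = cball b `\` cball a); last first.
  apply/seteqP; split=> x /=; rewrite /cball/=.
    by move=> /andP[xa xb]; split=> //; apply/negP; rewrite -ltNge.
  by move=> [xb /negP]; rewrite -ltNge => ->.
rewrite measureD ?lebesgueN_cball_lty//; [|exact: measurable_cball..].
rewrite setIidr; last by move=> x /le_trans; exact.
rewrite mulrBr EFinB; congr (_ - _); apply: lebesgueN_cball => //.
exact: le_trans ab.
Qed.

Lemma subrXX_le (a b : R) : (0 <= a <= b)%R ->
  (b ^+ N - a ^+ N <= N%:R * b ^+ N.-1 * (b - a))%R.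
Proof.
move=> /andP[a0 ab]; rewrite subrXX mulrC ler_wpM2r ?subr_ge0//.
apply: (@le_trans _ _ (\sum_(i < N) b ^+ N.-1)%R).
  apply: ler_sum => i _; rewrite -[X in (_ <= _ ^+ X)%R](@subnK i); last first.
    by rewrite -ltnS prednK.
  rewrite exprD -subn1 subnAC subn1 ler_pM ?exprn_ge0 ?(le_trans a0 ab)//.
  by apply: lerXn2r; rewrite ?nnegrE ?(le_trans a0 ab).
by rewrite sumr_const card_ord mulr_natl.
Qed.

Local Notation wl := (wlength (@idfun R)).
Local Notation cleb := (@completed_lebesgue_measure R).

(** The area of the sphere of radius b, which bounds the derivative of the volume r -> omega r^N on
    [0, b]. *)
Definition shell_cst (b : R) : R := (omega * (N%:R * b ^+ N.-1))%R.

Lemma shell_cst_ge0 b : (0 <= b)%R -> (0 <= shell_cst b)%R.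
Proof.
by move=> b0; rewrite mulr_ge0 ?mulr_ge0 ?exprn_ge0//; exact/ltW/omega_gt0.
Qed.

(** A covering of E by half-open intervals pulls back to a covering by shells, and the shell over an
    interval, cut at radius b, has volume at most [shell_cst b] times the length of the interval. *)
Lemma lebesgue_outer_shell (b : R) (E : set R) : (0 < b)%R ->
  @lebesgue_outer R N [set x | (0 < enorm x <= b)%R /\ E (enorm x)] <=
  (shell_cst b)%:E * cleb E.
Proof.
move=> b0; rewrite /completed_lebesgue_measure/=.
rewrite /completed_lebesgue_stieltjes_measure/= /completed_measure_extension.
have C0 : (0 < shell_cst b)%R.
  by rewrite mulr_gt0 ?omega_gt0// mulr_gt0 ?exprn_gt0// ltr0n.
rewrite muleC -lee_pdivrMr//.
apply: le_ereal_inf_tmp => _ [F [mF EF] <-].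
rewrite lee_pdivrMr// muleC -nneseriesZl; last by move=> k _; exact: wlength_ge0.
pose S k : set 'rV[R]_N := [set x | (0 < enorm x <= b)%R /\ F k (enorm x)].
apply: (@le_trans _ _ (@lebesgue_outer R N (\bigcup_k S k))).
  apply: le_lebesgue_outer => x [xb /EF[k _ Fk]].
  by exists k.
apply: (le_trans (outer_measure_sigma_subadditive _ S)).
apply: lee_nneseries => [k _ _|k _]; first exact: outer_measure_ge0.
have [Fk|[[u v]/= uv Fk]] := (ocitvP (F k)).1 (mF k).
  rewrite {1}/S Fk (_ : [set x | _] = set0) ?outer_measure0.
    by rewrite mule_ge0// ?lee_fin ?ltW// wlength_ge0.
  by apply/seteqP; split=> x //= [].
pose u' := Num.max u 0%R; pose v' := Num.min v b.
have Suv : S k `<=` [set x | (u' < enorm x <= v')%R].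
  move=> x; rewrite /S Fk/= in_itv/= => -[/andP[x0 xb] /andP[ux xv]].
  by rewrite gt_max ux x0 le_min xv xb.
apply: (le_trans (le_lebesgue_outer Suv)).
rewrite Fk wlength_itv_bnd ?(ltW uv)//= -EFinM.
have [uv'|vu'] := leP u' v'; last first.
  rewrite (_ : [set x | _] = set0) ?outer_measure0.
    by rewrite lee_fin mulr_ge0// ?subr_ge0 (ltW uv, ltW C0).
  apply/seteqP; split=> x //= /andP[h1 h2].
  by have := lt_le_trans h1 h2; rewrite ltNge ltW.
have u'0 : (0 <= u')%R by rewrite le_max lexx orbT.
have -> : @lebesgue_outer R N [set x | (u' < enorm x <= v')%R] =
    (omega * (v' ^+ N - u' ^+ N))%:E.
  by apply: lebesgueN_shell; rewrite u'0.
rewrite lee_fin /shell_cst -[leRHS]mulrA ler_wpM2l ?(ltW omega_gt0)//.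
apply: (le_trans (subrXX_le _)); first by rewrite u'0.
apply: ler_pM.
- by rewrite mulr_ge0// exprn_ge0// (le_trans u'0).
- by rewrite subr_ge0.
- rewrite ler_wpM2l// lerXn2r ?nnegrE ?(le_trans u'0)// ?ge_min ?lexx ?orbT//.
  by rewrite (le_trans uv')// ge_min lexx orbT.
- apply: lerB; first by rewrite ge_min lexx.
  by rewrite le_max lexx.
Qed.

(** A set of outer measure zero splits every set additively, hence is measurable. *)
Lemma lebesgue_outer0_negligible (E : set (@RN R N)) :
  @lebesgue_outer R N E = 0 -> mu.-negligible E.
Proof.
move=> E0; exists E; split => //.
apply: le_caratheodory_measurable => X.
apply: (@le_trans _ _ (@lebesgue_outer R N E + @lebesgue_outer R N X)).
  by apply: leeD; apply: le_lebesgue_outer; [exact: subIsetr|exact: subIsetl].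
by rewrite E0 add0e.
Qed.

Lemma lebesgueN_complete : measure_is_complete mu.
Proof. exact: measure_is_complete_caratheodory. Qed.

(** The exhaustion by 0 < |x| <= n + 1 is there because the constant of the shell estimate depends
    on the outer radius. *)
Lemma negligible_enorm (E : set R) : cleb.-negligible E ->
  mu.-negligible [set x | x != 0%R /\ E (enorm x)].
Proof.
move=> [A [mA A0 EA]].
rewrite (_ : [set x | _] = \bigcup_n
   [set x : @RN R N | (0 < enorm x <= n.+1%:R)%R /\ E (enorm x)]); last first.
  apply/seteqP; split=> x /=.
    rewrite -enorm_gt0 => -[x0 Ex].
    exists (Num.truncn (enorm x)) => //=.
    by rewrite x0 ltW// truncnS_gt.
  by move=> [n _ [/andP[x0 _] Ex]]; rewrite -enorm_gt0.
apply: negligible_bigcup => n.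
apply: lebesgue_outer0_negligible.
apply/eqP; rewrite eq_le outer_measure_ge0 andbT.
apply: (le_trans (lebesgue_outer_shell E _)); first by rewrite ltr0n.
have -> : cleb E = 0; last by rewrite mule0.
apply/eqP; rewrite eq_le measure_ge0 andbT -A0.
exact: le_outer_measure.
Qed.

Lemma ae_enorm (P : R -> Prop) : {ae cleb, forall r, P r} ->
  {ae mu, forall x, x != 0%R -> P (enorm x)}.
Proof.
move=> /negligible_enorm; apply: negligibleS => x /= /not_implyP[x0 nP].
by split.
Qed.

(** A Lebesgue measurable set of radii is the union of a Borel set and a null set. The first pulls
    back by continuity of the norm, the second by [negligible_enorm] and completeness. V and K are
    measurable in this sense, not in the Borel sense. *)
Lemma enorm_preimage_measurable (E : set R) :
  measurable (E : set (caratheodory_type (wl^*)%mu)) ->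
  measurable ((@enorm R N @^-1` E) : set (@RN R N)).
Proof.
rewrite -completed_caratheodory_measurable g_sigma_completed_algebra_genE.
move=> [A mA [B nB <-]].
rewrite preimage_setU; apply: measurableU.
  by rewrite -[X in measurable X]setTI; exact: enorm_measurable.
rewrite (_ : _ @^-1` B = [set x | x != 0%R /\ B (enorm x)] `|`
    ([set 0%R] `&` [set x | B (enorm x)])); last first.
  apply/seteqP; split=> x /=; last by case=> -[].
  by have [->|x0] := eqVneq x 0%R => Bx; [right|left].
have nm : mu.-negligible `<=` (measurable : set (set (@RN R N))).
  exact: lebesgueN_complete.
apply: measurableU; apply: nm.
  apply: negligible_enorm.
  case: nB => C [mC C0 BC]; exists C; split => //.
  exact: sub_caratheodory.
by apply: lebesgue_outer0_negligible; apply/eqP; rewrite eq_le outer_measure_ge0 andbT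
  -lebesgueN_set1_0 le_lebesgue_outer.
Qed.

End balls.

(** * Integrals of radial functions *)

Section radial_integrals.
Context {R : realType} {N : nat}.
Hypothesis N0 : (0 < N)%N.
Local Notation mu := (@lebesgueN R N).
Local Notation wl := (wlength (@idfun R)).
Local Notation cara := (caratheodory_type (wl^*)%mu).
Local Notation cleb := (@completed_lebesgue_measure R).
Local Open Scope ereal_scope.

Lemma measurable_punctured : measurable (punctured : set (@RN R N)).
Proof.
by apply: measurableC; apply: compact_measurable_RN; exact: compact_set1.
Qed.

Lemma negligible_set1_0 : mu.-negligible [set 0%R].
Proof.
apply: lebesgue_outer0_negligible; exact: (lebesgueN_set1_0 N0).
Qed.

Lemma enorm_punctured : @enorm R N @` punctured `<=` `]0%R, +oo[.
Proof.
by move=> _ [x /eqP x0 <-]; rewrite /= in_itv/= enorm_gt0 x0.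
Qed.

Lemma measurable_comp_enorm (f : R -> R) :
  measurable_fun (`]0%R, +oo[ : set R) f ->
  measurable_fun (punctured : set (@RN R N)) (f \o enorm).
Proof.
move=> mf; apply: (@measurable_comp _ _ _ (@RN R N) (measurableTypeR R)
  (measurableTypeR R) `]0%R, +oo[ f punctured (@enorm R N)) => //.
  exact: enorm_punctured.
exact/measurable_funTS/enorm_measurable.
Qed.

Lemma enorm_measurable_cara (D : set (@RN R N)) :
  measurable_fun D (@enorm R N : @RN R N -> cara).
Proof.
apply: measurable_funTS => mD E mE; rewrite setTI.
exact: enorm_preimage_measurable.
Qed.

Lemma measurable_cara_comp_enorm (f : R -> R) :
  measurable_fun (`]0%R, +oo[ : set cara) f ->
  measurable_fun (punctured : set (@RN R N)) (f \o enorm).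
Proof.
move=> mf; apply: (@measurable_comp _ _ _ (@RN R N) cara
  (measurableTypeR R) `]0%R, +oo[ f punctured (@enorm R N)) => //.
- exact: sub_caratheodory.
- exact: enorm_punctured.
- exact: enorm_measurable_cara.
Qed.

(** On an annulus the image of N-dimensional measure under the norm is dominated by [shell_cst b]
    times Lebesgue measure. This turns local integrability of V on the half-line into integrability
    of V(|x|) on annuli. *)
Lemma integral_comp_enorm_le (f : R -> R) (a b : R) : (0 < a <= b)%R ->
  (forall r, 0 < r -> 0 <= f r)%R ->
  measurable_fun (`]0%R, +oo[ : set cara) f ->
  \int[mu]_(x in [set x | (a <= enorm x <= b)%R]) (f (enorm x))%:E <=
  (@shell_cst R N b)%:E * \int[cleb]_(r in `[a, b]) (f r)%:E.
Proof.
move=> /andP[a0 ab] f0 mf.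
have b0 : (0 < b)%R by exact: lt_le_trans ab.
pose D : set cara := `[a, b]%classic.
have mD : measurable D by rewrite /D; apply: sub_caratheodory; exact: measurable_itv.
have D0 : D `<=` `]0%R, +oo[.
  by move=> r; rewrite /D/= !in_itv/= andbT => /andP[ar _]; exact: lt_le_trans ar.
have fD0 r : D r -> 0 <= (f r)%:E.
  by move=> /D0; rewrite /= in_itv/= andbT lee_fin; exact: f0.
have mfD : measurable_fun D (fun r => (f r)%:E).
  apply/measurable_EFinP; apply: measurable_funS D0 mf; exact: sub_caratheodory.
have me : measurable_fun [set: @RN R N] (@enorm R N : @RN R N -> cara).
  exact: enorm_measurable_cara.
have -> : [set x : 'rV[R]_N | (a <= enorm x <= b)%R] = @enorm R N @^-1` D.
  by apply/seteqP; split=> x; rewrite /D/= in_itv.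
have := @ge0_integral_pushforward _ _ _ _ _ _ me mu D (fun r => (f r)%:E) mD mfD.
rewrite /= => <-; last by move=> r; rewrite inE; exact: fD0.
have C0 : (0 <= @shell_cst R N b)%R by apply: shell_cst_ge0 => //; exact: ltW.
pose m1 := mrestr (pushforward mu (@enorm R N : @RN R N -> cara)) mD.
rewrite (@eq_measure_integral _ _ _ D m1); last first.
  move=> A mA AD; rewrite -{1}(setIidl AD).
  reflexivity.
rewrite (_ : @shell_cst R N b = (NngNum C0)%:num)//.
rewrite -ge0_integral_mscale//.
rewrite [leLHS]integral_mkcond [leRHS]integral_mkcond.
apply: ge0_le_measure_integral => //.
- move=> S mS; rewrite /m1 /mrestr /pushforward/= /mscale/=.
  apply: (le_trans _ (lebesgue_outer_shell N0 S b0)).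
  apply: le_lebesgue_outer => x [Sx]; rewrite /D/= in_itv/= => /andP[ax xb].
  by rewrite xb (lt_le_trans a0).
- by move=> r; apply: erestrict_ge0 => // ? ?; exact: fD0.
- exact/(measurable_restrictT _ mD).
Qed.

End radial_integrals.

Section power_integral.
Context {R : realType} {N : nat}.
Hypothesis N0 : (0 < N)%N.
Local Notation mu := (@lebesgueN R N).

Lemma punctured_enorm : punctured = [set x : 'rV[R]_N | 0 < enorm x].
Proof.
by apply/seteqP; split=> x; rewrite /punctured/= enorm_gt0 => /eqP.
Qed.

Lemma ler_npowR (x y t : R) : t <= 0 -> 0 < x <= y -> y `^ t <= x `^ t.
Proof.
move=> t0 /andP[x0 xy]; have y0 := lt_le_trans x0 xy.
rewrite -[t]opprK !(powRN _ (- t)) lef_pV2 ?posrE ?powR_gt0//.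
by apply: ge0_ler_powR; rewrite ?nnegrE ?oppr_ge0// ltW.
Qed.

Lemma dyadic_bracket (r : R) : 0 < r <= 1 ->
  exists k, 2^-1 ^+ k.+1 < r <= 2^-1 ^+ k.
Proof.
move=> /andP[r0 r1].
have [n nr] : exists n, 2^-1 ^+ n < r.
  exists (Num.truncn r^-1).+1; rewrite exprVn invf_plt ?posrE ?exprn_gt0//.
  apply: (lt_trans (truncnS_gt _)); rewrite -natrX ltr_nat.
  exact: ltn_expl.
have ex : exists n, 2^-1 ^+ n < r by exists n.
(* The least n with 2^-n < r is not 0, because r <= 1; its predecessor is k. *)
case: (ex_minnP ex) => -[|k] kr kmin.
  by move: kr; rewrite expr0 ltNge r1.
exists k; rewrite kr/= leNgt; apply/negP => /kmin.
by rewrite ltnn.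
Qed.

Lemma geometric_nneseries_le (C q : R) : 0 <= C -> 0 <= q < 1 ->
  (\sum_(k <oo) (C * q ^+ k)%:E <= (C / (1 - q))%:E)%E.
Proof.
move=> C0 /andP[q0 q1]; apply: lime_le.
  by apply: is_cvg_nneseries => k _ _; rewrite lee_fin mulr_ge0// exprn_ge0.
near=> n; rewrite sumEFin lee_fin -mulr_sumr; apply: ler_wpM2l => //.
have h : (1 - q) * \sum_(0 <= i < n) q ^+ i = 1 - q ^+ n.
  by rewrite big_mkord -(opprB q 1) mulNr -subrX1 opprB.
rewrite -[leRHS]mul1r ler_pdivlMr ?subr_gt0// mulrC h.
by rewrite gerBl exprn_ge0.
Unshelve. all: by end_near. Qed.

(** On the shell 2^-(k+1) < |x| <= 2^-k the integrand is at most a^(k+1), because tau <= 0, and the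
    ball containing the shell has volume omega 2^-(kN). The geometric series so obtained has ratio
    2^-(N + tau), below 1 because tau > -N. *)
Lemma integral_powR_enorm_lty (tau : R) : - N%:R < tau <= 0 ->
  (\int[mu]_(x in [set x | (0 < enorm x <= 1)%R]) (enorm x `^ tau)%:E < +oo)%E.
Proof.
move=> /andP[Ntau tau0].
pose a : R := 2^-1 `^ tau.
have a0 : 0 <= a by exact: powR_ge0.
pose D : set (@RN R N) := [set x | 0 < enorm x <= 1].
have mD : measurable D.
  rewrite (_ : D = enorm @^-1` [set` `]0, 1]]); last first.
    by apply/seteqP; split=> x; rewrite /D/= in_itv.
  by rewrite -[X in measurable X]setTI; exact: enorm_measurable.
have q1 : a * 2^-1 ^+ N < 1.
  rewrite -powR_mulrn// -powRD; last by apply/implyP.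
  rewrite [ltRHS](_ : _ = 1 `^ (tau + N%:R)); last by rewrite powR1.
  apply: gt0_ltr_powR; rewrite ?nnegrE//; first by lra.
  by rewrite invf_lt1 ?ltr1n.
apply: (@le_lt_trans _ _ (\int[mu]_(x in D) (\sum_(k <oo)
    (a ^+ k.+1 * \1_(cball (2^-1 ^+ k)) x)%:E))%E).
  rewrite -/D; apply: ge0_le_integral; first exact: mD.
  - by move=> x _; rewrite lee_fin powR_ge0.
  - apply/measurable_EFinP.
    apply: measurable_funS (@measurable_punctured R N) _ _.
      by rewrite punctured_enorm => x /andP[].
    apply: (@measurable_comp_enorm _ _ (fun r => r `^ tau)).
    by apply: measurable_funTS; exact: measurable_powR.
  - apply: ge0_emeasurable_sum => [k x _ _|k _].
      by rewrite lee_fin mulr_ge0// exprn_ge0.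
    apply/measurable_EFinP; apply: measurable_funM => //.
    apply: measurable_funTS.
    by apply: measurable_indic; exact: measurable_cball.
  - move=> x /dyadic_bracket[k /andP[kx xk]].
    have E : (a ^+ k.+1 * \1_(cball (2^-1 ^+ k)) x)%R = a ^+ k.+1.
      by rewrite indicE mem_set// mulr1.
    rewrite (@nneseriesD1 _ _ k) ?E//; last first.
      by move=> n _; rewrite lee_fin mulr_ge0 ?exprn_ge0.
    apply: (@le_trans _ _ (a ^+ k.+1)%:E); last first.
      rewrite leeDl//; apply: nneseries_ge0 => n _ _.
      by rewrite lee_fin mulr_ge0 ?exprn_ge0.
    have p0 : 0 < 2^-1 ^+ k.+1 :> R by rewrite exprn_gt0.
    rewrite lee_fin /a -powR_mulrn ?powR_ge0// -powRrM mulrC powRrM powR_mulrn//.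
    by apply: ler_npowR => //; rewrite p0 ltW.
rewrite (integral_nneseries _ mD); last 2 first.
- move=> k; apply/measurable_EFinP; apply: measurable_funM => //.
  apply: measurable_funTS.
  by apply: measurable_indic; exact: measurable_cball.
- by move=> k x _; rewrite lee_fin mulr_ge0// exprn_ge0.
apply: (@le_lt_trans _ _
   (\sum_(k <oo) ((a * @omega R N) * (a * 2^-1 ^+ N) ^+ k)%:E)%E); last first.
  apply: (le_lt_trans (geometric_nneseries_le _ _)); last exact: ltry.
    by rewrite mulr_ge0// ltW// omega_gt0.
  by rewrite q1 andbT mulr_ge0// exprn_ge0.
apply: lee_nneseries => [k _ _|k _].
  by apply: integral_ge0 => x _; rewrite lee_fin mulr_ge0// exprn_ge0.
under eq_integral do rewrite EFinM.
rewrite (ge0_integralZl _ mD); last 3 first.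
- apply/measurable_EFinP; apply: measurable_funTS.
  by apply: measurable_indic; exact: measurable_cball.
- by move=> x _; rewrite lee_fin.
- by rewrite lee_fin exprn_ge0.
rewrite integral_indic//; last exact: measurable_cball.
apply: (@le_trans _ _ ((a ^+ k.+1)%:E * mu (cball (2^-1 ^+ k)))%E).
  rewrite lee_wpmul2l ?lee_fin ?exprn_ge0//.
  exact: lebesgueN_le.
rewrite lebesgueN_cball ?exprn_ge0// -EFinM lee_fin.
rewrite exprMn exprS -!mulrA ler_wpM2l// mulrCA ler_wpM2l ?(ltW (omega_gt0 N0))//.
by rewrite -!exprM mulnC.
Qed.

End power_integral.

(** * Pointwise decay of radial functions *)

Section shell_integral.
Context {R : realType} {N : nat}.
Hypothesis N0 : (0 < N)%N.
Local Notation mu := (@lebesgueN R N).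
Variables (F : R -> R).
Hypothesis F_ge0 : forall r, 0 < r -> 0 <= F r.
Hypothesis F_cont : forall r, 0 < r -> {for r, continuous F}.
Hypothesis F_int :
  (\int[mu]_(x in punctured) (F (enorm x))%:E < +oo)%E.

Definition shell (a b : R) : set (@RN R N) := [set x | a < enorm x <= b].

Lemma measurable_shell a b : measurable (shell a b).
Proof.
rewrite (_ : shell a b = enorm @^-1` [set` `]a, b]]).
  by rewrite -[X in measurable X]setTI; exact: enorm_measurable.
by apply/seteqP; split=> x; rewrite /shell/= in_itv.
Qed.

Lemma shell_sub a b : 0 <= a -> shell a b `<=` punctured.
Proof.
by move=> a0; rewrite punctured_enorm => x /andP[ax _]; exact: le_lt_trans ax.
Qed.

Let mF : measurable_fun (punctured : set (@RN R N)) (fun x => (F (enorm x))%:E).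
Proof.
apply/measurable_EFinP; apply: (@measurable_comp_enorm _ _ F).
apply: open_continuous_measurable_fun => //.
by move=> r; rewrite inE/= in_itv/= andbT => /F_cont.
Qed.

Let mFshell a b : 0 <= a -> measurable_fun (shell a b) (fun x => (F (enorm x))%:E).
Proof.
by move=> a0; apply: measurable_funS mF; [exact: measurable_punctured|exact: shell_sub].
Qed.

Let F0shell a b x : 0 <= a -> shell a b x -> (0 <= (F (enorm x))%:E)%E.
Proof.
by move=> a0 /andP[ax _]; rewrite lee_fin F_ge0//; exact: le_lt_trans ax.
Qed.

Definition Ishell (a b : R) : R :=
  fine (\int[mu]_(x in shell a b) (F (enorm x))%:E).

Lemma integral_shell_le a b : 0 <= a ->
  (\int[mu]_(x in shell a b) (F (enorm x))%:E <=
   \int[mu]_(x in punctured) (F (enorm x))%:E)%E.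
Proof.
move=> a0; apply: ge0_subset_integral.
- exact: measurable_shell.
- exact: measurable_punctured.
- exact: mF.
- by rewrite punctured_enorm => x /F_ge0; rewrite lee_fin.
- exact: shell_sub.
Qed.

Lemma IshellE a b : 0 <= a ->
  (\int[mu]_(x in shell a b) (F (enorm x))%:E)%E = (Ishell a b)%:E.
Proof.
move=> a0; rewrite fineK// ge0_fin_numE.
  exact: (le_lt_trans (integral_shell_le _ a0)).
by apply: integral_ge0 => x; exact: F0shell.
Qed.

Lemma Ishell_cat a b c : 0 <= a -> a <= b <= c ->
  Ishell a c = Ishell a b + Ishell b c.
Proof.
move=> a0 /andP[ab bc]; have b0 := le_trans a0 ab.
apply: EFin_inj; rewrite EFinD -!IshellE//.
have E : shell a c = shell a b `|` shell b c.
  apply/seteqP; split=> x /=; rewrite /shell/=.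
    by case/andP=> ax xc; have [xb|bx] := leP (enorm x) b; [left|right];
      rewrite ?ax ?xb ?bx.
  by case=> /andP[h1 h2]; rewrite ?h1 ?h2 ?(le_trans h2)// (le_lt_trans ab).
rewrite E; apply: ge0_integral_setU.
- exact: measurable_shell.
- exact: measurable_shell.
- by rewrite -E; exact: mFshell.
- by rewrite -E => x; exact: F0shell.
- apply/disj_setPS => x [/andP[_ xb] /andP[bx _]].
  by have := le_lt_trans xb bx; rewrite ltxx.
Qed.

Let vol (r : R) : R := @omega R N * r ^+ N.

Lemma Ishell_le a b M : 0 <= a <= b -> (forall t, a < t <= b -> F t <= M) ->
  Ishell a b <= M * (vol b - vol a).
Proof.
move=> /andP[a0 ab] FM; rewrite -lee_fin -IshellE//.
have [eqab|neab] := eqVneq a b.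
  rewrite eqab subrr mulr0 (_ : shell b b = set0) ?integral_set0//.
  apply/seteqP; split=> x //= /andP[h1 h2].
  by have := lt_le_trans h1 h2; rewrite ltxx.
have ltab : a < b by rewrite lt_neqAle neab.
have M0 : 0 <= M.
  by apply: (le_trans _ (FM b _)); rewrite ?F_ge0 ?ltab ?lexx// (le_lt_trans a0).
apply: (@le_trans _ _ (\int[mu]_(x in shell a b) (cst M%:E x))%E).
  apply: ge0_le_integral.
  - exact: measurable_shell.
  - by move=> x; exact: F0shell.
  - exact: mFshell.
  - exact: measurable_cst.
  - by move=> x ?; rewrite lee_fin FM.
rewrite integral_cst; last exact: measurable_shell.
rewrite [X in (_ * X)%E](_ : _ = (@omega R N * (b ^+ N - a ^+ N))%:E); last first.
  by apply: lebesgueN_shell => //; rewrite a0.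
by rewrite -EFinM /vol -mulrBr.
Qed.

Lemma Ishell_ge a b m : 0 <= a <= b -> (forall t, a < t <= b -> m <= F t) ->
  m * (vol b - vol a) <= Ishell a b.
Proof.
move=> /andP[a0 ab] Fm.
have volab : 0 <= vol b - vol a.
  rewrite -mulrBr mulr_ge0 ?(ltW (omega_gt0 N0))// subr_ge0.
  by rewrite lerXn2r ?nnegrE// (le_trans a0).
have I0 : 0 <= Ishell a b.
  by rewrite fine_ge0// integral_ge0// => x; exact: F0shell.
have [m0|m0] := ltP m 0; first by rewrite (le_trans _ I0)// mulr_le0_ge0// ltW.
rewrite -lee_fin -IshellE//.
apply: (@le_trans _ _ (\int[mu]_(x in shell a b) (cst m%:E x))%E); last first.
  apply: ge0_le_integral.
  - exact: measurable_shell.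
  - by move=> x _; rewrite lee_fin.
  - exact: measurable_cst.
  - exact: mFshell.
  - by move=> x ?; rewrite lee_fin Fm.
rewrite integral_cst; last exact: measurable_shell.
rewrite [X in (_ * X)%E](_ : _ = (@omega R N * (b ^+ N - a ^+ N))%:E); last first.
  by apply: lebesgueN_shell => //; rewrite a0.
by rewrite -EFinM /vol -mulrBr.
Qed.

(** The increment of the integral is compared with that of the volume instead of s - r: near r the
    function F differs from F r by at most e, and this integrates over the shell between r and s. *)
Lemma Ishell_approx (rho r e : R) : 0 < rho < r -> 0 < e ->
  \forall s \near r, `|Ishell rho s - Ishell rho r - F r * (vol s - vol r)| <=
    e * `|vol s - vol r|.
Proof.
move=> /andP[rho0 rr] e0; have r0 := lt_trans rho0 rr.
have /cvgrPdist_le/(_ e e0)/nbhs_ballP[d /= d0 dF] := F_cont r0.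
have key a b : 0 < a -> a <= b -> `|r - a| < d -> `|r - b| < d ->
   `|Ishell a b - F r * (vol b - vol a)| <= e * (vol b - vol a).
  move=> a0 ab ad bd.
  have h t : a < t <= b -> F r - e <= F t <= F r + e.
    move=> /andP[at' tb].
    have /dF : `|r - t| < d.
      move: ad bd; rewrite !ltr_norml => /andP[? ?] /andP[? ?].
      by apply/andP; split; lra.
    by rewrite /= ler_norml => /andP[? ?]; apply/andP; split; lra.
  have a0b : 0 <= a <= b by rewrite ltW.
  have /(_ (F r - e)) := @Ishell_ge a b _ a0b.
  move=> /(_ (fun t h' => proj1 (andP (h t h')))).
  have /(_ (F r + e)) := @Ishell_le a b _ a0b.
  move=> /(_ (fun t h' => proj2 (andP (h t h')))).
  by rewrite ler_norml !mulrDl mulNr; lra.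
near=> s.
have s0 : rho < s by near: s; exact: lt_nbhsr.
have sd : `|r - s| < d by near: s; exact: (@nbhsx_ballx _ _ r d).
have rd : `|r - r| < d by rewrite subrr normr0.
have volm a b : 0 <= a -> a <= b -> vol a <= vol b.
  move=> a0 ab; apply: ler_wpM2l; first exact/ltW/omega_gt0.
  by apply: lerXn2r; rewrite ?nnegrE// (le_trans a0).
have [rs|/ltW sr] := leP r s.
  rewrite (@Ishell_cat rho r s) ?(ltW rho0) ?(ltW rr)//.
  rewrite [X in `|X - _|](_ : _ = Ishell r s); last by ring.
  rewrite [X in _ <= e * X]ger0_norm ?subr_ge0 ?volm ?(ltW r0)//.
  exact: key.
rewrite (@Ishell_cat rho s r) ?(ltW rho0) ?(ltW s0)//.
rewrite [X in `|X|](_ : _ = - (Ishell s r - F r * (vol r - vol s))); last by ring.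
rewrite normrN (distrC (vol s)).
rewrite [X in _ <= e * X]ger0_norm ?subr_ge0 ?volm ?(ltW (lt_trans rho0 s0))//.
by apply: key; rewrite ?(lt_trans rho0 s0).
Unshelve. all: by end_near. Qed.

(** The fundamental theorem of calculus in the radial variable. The difference quotient is the ratio
    of the increments of [Ishell] and of the volume, which tends to F r, times the difference
    quotient of omega r^N. *)
Lemma is_derive_Ishell (rho r : R) : 0 < rho < r ->
  is_derive r 1 (Ishell rho) (@omega R N * (N%:R * r ^+ N.-1) * F r).
Proof.
move=> rr; have /andP[rho0 rhor] := rr; have r0 := lt_trans rho0 rhor.
have dvol : is_derive r 1 vol (@omega R N * (N%:R * r ^+ N.-1)).
  have dX : is_derive r 1 (fun s : R => s ^+ N) (N%:R * r ^+ N.-1).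
    have := @is_deriveX R R id N r 1 1 (is_derive_id r 1).
    rewrite exprfctE => h; apply: (is_derive_eq h).
    by rewrite /GRing.scale/= mulr1.
  apply: (is_derive_eq (is_deriveZ (omega : R) dX)).
  by [].
have cvol : h^-1 *: (vol (h *: 1 + r) - vol r) @[h --> 0^'] -->
    @omega R N * (N%:R * r ^+ N.-1).
  case: dvol => dv <-; exact: dv.
(* The factorisation divides by the increment of the volume, nonzero because r -> r^N is injective
   on positive radii. *)
have nz : \forall h \near 0^', h != 0 :> R /\ vol (h *: 1 + r) - vol r != 0.
  near=> h.
  have h0 : h != 0 by near: h; exact: nbhs_dnbhs_neq.
  have hr : 0 < h *: 1 + r.
    have : `|h| < r by near: h; exact: dnbhs0_lt.
    by rewrite /GRing.scale/= mulr1 ltr_norml => /andP[]; lra.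
  split => //; rewrite -mulrBr mulf_neq0//; first by rewrite gt_eqF ?omega_gt0.
  rewrite subr_eq0.
  rewrite eqrXn2 ?(ltW hr) ?(ltW r0)//.
  by rewrite /GRing.scale/= mulr1 -subr_eq0 addrK.
have crho : (Ishell rho (h *: 1 + r) - Ishell rho r) / (vol (h *: 1 + r) - vol r)
   @[h --> 0^'] --> F r.
  apply/cvgrPdist_le => e e0.
  have shiftc : (h *: 1 + r) @[h --> (0 : R)^'] --> r.
    have : (h *: 1 + r) @[h --> (0 : R)] --> 0 *: 1 + r.
      by apply: cvgD; [apply: cvgZr_tmp; exact: cvg_id|exact: cvg_cst].
    rewrite scale0r add0r; apply: cvg_trans; apply: cvg_app; exact: nbhs_dnbhs.
  have app := shiftc _ (Ishell_approx rr e0).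
  near=> h.
  have [h0 v0] : h != 0 :> R /\ vol (h *: 1 + r) - vol r != 0 by near: h.
  have : `|Ishell rho (h *: 1 + r) - Ishell rho r - F r * (vol (h *: 1 + r) - vol r)| <=
    e * `|vol (h *: 1 + r) - vol r|.
    by near: h; exact: app.
  move=> H; rewrite distrC -(@ler_pM2r _ `|vol (h *: 1 + r) - vol r|) ?normr_gt0//.
  rewrite -normrM mulrBl mulfVK//.
have L : h^-1 *: (Ishell rho (h *: 1 + r) - Ishell rho r) @[h --> 0^'] -->
    @omega R N * (N%:R * r ^+ N.-1) * F r.
  rewrite mulrC; apply: cvg_trans (cvgM crho cvol); apply: near_eq_cvg.
  near=> h.
  have [h0 v0] : h != 0 :> R /\ vol (h *: 1 + r) - vol r != 0 by near: h.
  transitivity ((Ishell rho (h *: 1 + r) - Ishell rho r) /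
    (vol (h *: 1 + r) - vol r) * (h^-1 * (vol (h *: 1 + r) - vol r))) => //.
  by rewrite mulrCA mulfVK.
apply: DeriveDef; last exact: cvg_lim L.
by apply/cvg_ex; exists (@omega R N * (N%:R * r ^+ N.-1) * F r).
Unshelve. all: by end_near. Qed.

End shell_integral.

(** Young's inequality with exponents p and p / (p - 1) for the factors B^(1/p) y and B^(-1/p),
    whose product is y; the weights 1/p and (p - 1)/p are at most 1 and are dropped. *)
Lemma young_weighted {R : realType} (p B y : R) : 1 < p -> 0 < B -> 0 <= y ->
  y <= B * y `^ p + B `^ (- (p - 1)^-1).
Proof.
move=> p1 B0 y0.
have p0 : 0 < p by rewrite (lt_trans _ p1).
have pm0 : 0 < p - 1 by rewrite subr_gt0.
pose q := p / (p - 1).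
have q1 : 1 <= q by rewrite ler_pdivlMr// mul1r gerBl.
have q0 : 0 < q by exact: lt_le_trans q1.
have pq : p^-1 + q^-1 = 1.
  rewrite /q invf_div; field.
  by rewrite !gt_eqF.
have := @conjugate_powR R (B `^ p^-1 * y) (B `^ (- p^-1)) p q.
rewrite mulr_ge0 ?powR_ge0// => /(_ erefl erefl p0 q0 pq).
have -> : B `^ p^-1 * y * B `^ (- p^-1) = y.
  by rewrite mulrAC -powRD ?subrr ?powRr0 ?mul1r// (gt_eqF B0) implybT.
rewrite powRM ?powR_ge0// -!powRrM mulVf ?gt_eqF// powRr1 ?(ltW B0)//.
have -> : - p^-1 * q = - (p - 1)^-1.
  rewrite /q; field.
  by rewrite !gt_eqF.
move/le_trans; apply; apply: lerD.
  by rewrite ler_pdivrMr// ler_peMr ?(ltW p1)// mulr_ge0 ?powR_ge0// ltW.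
by rewrite ler_pdivrMr// ler_peMr// powR_ge0.
Qed.

Lemma continuous_norm_powR {R : realType} (p : R) : 0 < p ->
  continuous (fun y : R => `|y| `^ p).
Proof.
move=> p0 y; have [->|y0] := eqVneq y 0.
  rewrite /continuous_at normr0 powR0 ?gt_eqF//.
  apply/cvgrPdist_lt => e e0.
  have h : \forall t \near (0 : R), `|t| < e `^ p^-1.
    by apply: nbhs0_lt; rewrite powR_gt0.
  near=> t; rewrite sub0r normrN ger0_norm ?powR_ge0//.
  have -> : e = (e `^ p^-1) `^ p.
    by rewrite -powRrM mulVf ?gt_eqF// powRr1// ltW.
  apply: gt0_ltr_powR; rewrite ?nnegrE ?powR_ge0//.
  by near: t; exact: h.
apply: (@continuous_comp _ _ _ (fun y : R => `|y|) (fun y => y `^ p)).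
  exact: norm_continuous.
have y0' : 0 < `|y| by rewrite normr_gt0.
apply: differentiable_continuous; apply/derivable1_diffP.
by case: (is_derive1_powR p y0').
Unshelve. all: by end_near. Qed.

(** * The oscillation of a radial profile *)

Section oscillation.
Context {R : realType} {N : nat}.
Hypothesis N0 : (0 < N)%N.
Local Notation mu := (@lebesgueN R N).
Variables (p a c : R).
Hypotheses (p1 : 1 < p) (pNa : p - N%:R < a) (c0 : 0 < c).
Variables (A phi dphi : R -> R).
Hypothesis A0 : forall r, 0 < r -> 0 < A r.
Hypothesis A_cont : forall r, 0 < r -> {for r, continuous A}.
Hypothesis dphiP : forall r : R, 0 < r -> is_derive r 1 phi (dphi r).
Hypothesis dphi_cont : forall r, 0 < r -> {for r, continuous dphi}.

Definition decay : R := (N%:R - p + a) / p.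

(** The power -1/(p - 1) is that of the remainder in [young_weighted]; the denominator m = (N - p +
    a) / (p - 1) comes from the primitive -r^(-m) / m of r^(-m-1). *)
Definition osc_cst : R :=
  (@omega R N * N%:R * c) `^ (- (p - 1)^-1) / ((N%:R - p + a) / (p - 1)).

Let F r := A r * `|dphi r| `^ p.

Lemma oscillation (E r0 r1 : R) :
  (\int[mu]_(x in punctured) (F (enorm x))%:E <= E%:E)%E ->
  0 < r0 <= r1 -> (forall r, r0 <= r <= r1 -> c * r `^ a <= A r) ->
  `|phi r1 - phi r0| <= r0 `^ (- decay) * (E + osc_cst).
Proof.
move=> FE /andP[r00 r01] cA.
have p0 : 0 < p by rewrite (lt_trans _ p1).
have pm0 : 0 < p - 1 by rewrite subr_gt0.
have F_ge0 r : 0 < r -> 0 <= F r.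
  by move=> r0'; rewrite mulr_ge0 ?powR_ge0// ltW ?A0.
have F_cont r : 0 < r -> {for r, continuous F}.
  move=> r0'; apply: cvgM; first exact: A_cont.
  apply: (@continuous_comp _ _ _ dphi (fun y => `|y| `^ p)); first exact: dphi_cont.
  exact: continuous_norm_powR.
have F_int : (\int[mu]_(x in punctured) (F (enorm x))%:E < +oo)%E.
  by apply: (le_lt_trans FE); exact: ltry.
have IE s : 0 <= s -> @Ishell R N F s r1 <= E.
  move=> s0; rewrite -lee_fin -IshellE//.
  by apply: le_trans FE; exact: integral_shell_le.
pose d : R := N%:R - p + a.
have d0 : 0 < d.
  by move: pNa; rewrite -subr_gt0 /d; congr (0 < _); ring.
pose nu : R := decay.
pose m : R := d / (p - 1).
have m0 : 0 < m by rewrite divr_gt0.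
pose lam : R := r0 `^ (- nu).
have lam0 : 0 < lam by rewrite powR_gt0.
have [kap kapE] : exists k0 : R, k0 = @omega R N * N%:R by eexists.
have kap0 : 0 < kap by rewrite kapE mulr_gt0 ?omega_gt0 ?ltr0n.
pose k : R := lam `^ (- (p - 1)^-1) * (kap * c) `^ (- (p - 1)^-1).
pose W (r : R) := m^-1 * r `^ (- m).
(* The base radius lies strictly below r0, so that [Ishell] is differentiable at r0 too. *)
pose rho : R := r0 / 2.
have rho0 : 0 < rho by rewrite divr_gt0.
have rhor r : r0 <= r -> rho < r.
  by apply: lt_le_trans; rewrite /rho; lra.
(* For s = 1 and s = -1 the function T s is nondecreasing on [r0, r1]: by
   Young's inequality, the derivative of lam * Ishell - k * W dominates |dphi|.
   The weight lam is chosen so that both terms scale like r0^(-decay). *)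
pose T (s : R) r := lam * @Ishell R N F rho r - k * W r + s * phi r.
have dW (r : R) : 0 < r -> is_derive r 1 W (- r `^ (- m - 1)).
  move=> r_gt0; apply: (is_derive_eq (is_deriveZ m^-1 (is_derive1_powR (- m) r_gt0))).
  by rewrite /GRing.scale/= mulrA mulrN mulVf ?gt_eqF// mulN1r.
have dT (s r : R) : r0 <= r -> is_derive r 1 (T s)
   (lam * (@omega R N * (N%:R * r ^+ N.-1) * F r) + k * r `^ (- m - 1) + s * dphi r).
  move=> rr.
  have r_gt0 : 0 < r by exact: lt_le_trans rr.
  have rhorr : 0 < rho < r by rewrite rho0 rhor.
  have dI := is_derive_Ishell N0 F_ge0 F_cont F_int rhorr.
  apply: (is_derive_eq (is_deriveD (is_deriveB (is_deriveZ lam dI)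
    (is_deriveZ k (dW _ r_gt0))) (is_deriveZ s (dphiP r_gt0)))).
  by rewrite /GRing.scale/= mulrN opprK.
(* Young's inequality with B = lam omega N r^(N-1) A(r): the first term is lam times the derivative
   of [Ishell], and A(r) >= c r^a bounds the remainder by k r^(-m-1), as (N - 1 + a) / (p - 1) = m +
   1. *)
have dphi_le (r : R) : r0 <= r <= r1 -> `|dphi r| <=
    lam * (@omega R N * (N%:R * r ^+ N.-1) * F r) + k * r `^ (- m - 1).
  move=> /andP[rr rr1].
  have r_gt0 : 0 < r by exact: lt_le_trans rr.
  pose B := lam * (kap * r ^+ N.-1) * A r.
  have rN0 : 0 < r ^+ N.-1 by rewrite exprn_gt0.
  have B0 : 0 < B := mulr_gt0 (mulr_gt0 lam0 (mulr_gt0 kap0 rN0)) (A0 r_gt0).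
  have /le_trans := young_weighted p1 B0 (normr_ge0 (dphi r)); apply.
  apply: lerD; first by rewrite /B /F kapE !mulrA.
  have Bc : lam * (kap * c) * r `^ (N%:R - 1 + a) <= B.
    rewrite (_ : r `^ _ = r ^+ N.-1 * r `^ a).
      rewrite /B -!mulrA; do 2 (rewrite ler_pM2l//).
      by rewrite mulrCA ler_pM2l// cA// rr.
    rewrite -powR_mulrn ?(ltW r_gt0)// -powRD ?(gt_eqF r_gt0) ?implybT//.
    by rewrite -subn1 natrB.
  have Bc0 : 0 < lam * (kap * c) * r `^ (N%:R - 1 + a).
    exact: (mulr_gt0 (mulr_gt0 lam0 (mulr_gt0 kap0 c0)) (powR_gt0 _ r_gt0)).
  apply: (@le_trans _ _ ((lam * (kap * c) * r `^ (N%:R - 1 + a)) `^ (- (p - 1)^-1))).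
    apply: ler_npowR; last by rewrite Bc0.
    by rewrite oppr_le0 invr_ge0 ltW.
  have kc0 := mulr_gt0 kap0 c0.
  rewrite (powRM _ (ltW (mulr_gt0 lam0 kc0)) (powR_ge0 _ _)).
  rewrite (powRM _ (ltW lam0) (ltW kc0)) -powRrM.
  rewrite (_ : (N%:R - 1 + a) * _ = - m - 1)//.
  rewrite /m /d; field.
  by rewrite gt_eqF.
have key (s : R) : (s == 1) || (s == -1) -> T s r0 <= T s r1.
  move=> s1.
  apply: (@ger0_derive1_ndecr _ (T s) r0 r1); rewrite ?lexx//.
  - move=> r; rewrite in_itv/= => /andP[r0r _].
    by case: (dT s r (ltW r0r)).
  - move=> r; rewrite in_itv/= => /andP[r0r rr1].
    rewrite derive1E; case: (dT s r (ltW r0r)) => _ ->.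
    have rr : r0 <= r <= r1 by rewrite (ltW r0r) (ltW rr1).
    have := dphi_le r rr.
    have : `|dphi r| = `|s * dphi r|.
      by rewrite normrM; case/orP : s1 => /eqP ->; rewrite ?normrN normr1 mul1r.
    by move=> ->; rewrite ler_norml => /andP[h _]; rewrite -lerBlDl sub0r.
  - apply: derivable_within_continuous => r; rewrite in_itv/= => /andP[r0r _].
    by case: (dT s r r0r).
have lamk : lam * osc_cst = k * W r0.
  have -> : osc_cst = (kap * c) `^ (- (p - 1)^-1) * m^-1 by rewrite kapE.
  (* This holds because nu / (p - 1) - m = -nu. *)
  have E1 : lam `^ (- (p - 1)^-1) * r0 `^ (- m) = lam.
    rewrite /lam -powRrM -powRD ?(gt_eqF r00) ?implybT//.
    congr (_ `^ _); rewrite /nu /decay /m /d; field.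
    by rewrite !gt_eqF.
  rewrite /W /k -{1}E1.
  move: (lam `^ _) (r0 `^ _) ((kap * c) `^ _) m^-1 => x y z t.
  by ring.
have W1 : 0 <= k * W r1 by rewrite !mulr_ge0 ?powR_ge0 ?invr_ge0 ?(ltW m0).
have II : lam * @Ishell R N F rho r1 - lam * @Ishell R N F rho r0 <= lam * E.
  rewrite -mulrBr ler_wpM2l ?(ltW lam0)//.
  have hr : rho <= r0 <= r1 by rewrite r01 (ltW (rhor _ (lexx _))).
  rewrite (Ishell_cat F_ge0 F_cont F_int (ltW rho0) hr).
  by rewrite addrAC subrr add0r IE ?(ltW r00).
have k1 : T 1 r0 <= T 1 r1 by apply: key; rewrite eqxx.
have k2 : T (-1) r0 <= T (-1) r1 by apply: key; rewrite eqxx orbT.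
rewrite -/nu -/lam mulrDr lamk ler_norml.
move: k1 k2 II W1; rewrite /T !mulN1r !mul1r.
move: (lam * _) (lam * _) (lam * _) (k * _) (k * _) (phi r1) (phi r0) => x y z t u v w.
by move=> *; apply/andP; split; lra.
Qed.

End oscillation.

Section punctured_integral.
Context {R : realType} {N : nat}.
Hypothesis N0 : (0 < N)%N.
Local Notation mu := (@lebesgueN R N).

(** The origin is a null set and the measure is complete, so values there are free; the hypotheses
    on A, V and K concern positive radii. *)
Lemma measurable_fun_punctured (f : @RN R N -> \bar R) :
  measurable_fun (punctured : set (@RN R N)) f -> measurable_fun [set: @RN R N] f.
Proof.
move=> mf; rewrite -(setvU [set 0%R : @RN R N]).
apply/measurable_funU.
- exact: measurable_punctured.
- by apply: compact_measurable_RN; exact: compact_set1.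
split => // mD B mB.
apply: lebesgueN_complete.
by apply: negligibleS (negligible_set1_0 N0); exact: subIsetl.
Qed.

Lemma integral_punctured (f : @RN R N -> \bar R) :
  measurable_fun (punctured : set (@RN R N)) f ->
  (\int[mu]_x f x = \int[mu]_(x in punctured) f x)%E.
Proof.
move=> mf; have mfT := measurable_fun_punctured mf.
have m0 : measurable ([set 0%R] : set (@RN R N)).
  by apply: compact_measurable_RN; exact: compact_set1.
have E : punctured = [set: @RN R N] `\` [set 0%R] by rewrite setTD.
rewrite integralE [RHS]integralE E; congr (_ - _)%E.
- apply: (ge0_negligible_integral m0) => //.
    exact: measurable_funepos.
  exact: (lebesgueN_set1_0 N0).
- apply: (ge0_negligible_integral m0) => //.
    exact: measurable_funeneg.
  exact: (lebesgueN_set1_0 N0).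
Qed.

End punctured_integral.

(** * Derivatives of radial functions *)

Section line_derivative.
Context {R : realType} {V : normedModType R}.
Implicit Types (f : V -> R) (x v : V).

Lemma is_derive_line f x v (t df : R) :
  is_derive (t *: v + x) v f df <->
  is_derive t 1 (fun s : R => f (s *: v + x)) df.
Proof.
have E : (fun h : R => h^-1 *: (((fun s : R => f (s *: v + x)) \o shift t) (h *: 1)
      - f (t *: v + x))) =
    (fun h : R => h^-1 *: ((f \o shift (t *: v + x)) (h *: v) - f (t *: v + x))).
  by apply/funext => h /=; rewrite [h *: 1]mulr1 scalerDl addrA.
by split=> -[dd dv]; apply: DeriveDef; move: dd dv; rewrite /derivable /derive E.
Qed.

Lemma is_derive_line0 f x v (df : R) :
  is_derive x v f df <-> is_derive (0 : R) 1 (fun t : R => f (t *: v + x)) df.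
Proof. by rewrite -is_derive_line scale0r add0r. Qed.

Lemma is_derive_comp (g : R -> R) f x v (dg df : R) :
  is_derive (f x) 1 g dg -> is_derive x v f df ->
  is_derive x v (g \o f) (dg * df).
Proof.
move=> d2 /is_derive_line0 d1; apply/is_derive_line0.
apply: (@is_derive1_comp R g (fun t : R => f (t *: v + x)) 0 _ _ _ d1).
by rewrite scale0r add0r.
Qed.

End line_derivative.

Section radial_functions.
Context {R : realType} {N : nat}.
Variable i0 : 'I_N.
Local Notation mu := (@lebesgueN R N).
Implicit Types (u : 'rV[R]_N -> R) (x : 'rV[R]_N).

Definition ray (r : R) : 'rV[R]_N := r *: 'e_i0.

Lemma enorm_e (i : 'I_N) : enorm ('e_i : 'rV[R]_N) = 1.
Proof.
rewrite /enorm (bigD1 i)//= big1 ?addr0 => [|j /negPf ji].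
  by rewrite mxE !eqxx expr1n sqrtr1.
by rewrite mxE ji andbF expr0n.
Qed.

Lemma enorm_ray r : 0 <= r -> enorm (ray r) = r.
Proof. by move=> r0; rewrite enormZ enorm_e mulr1 ger0_norm. Qed.

Definition profile u (r : R) : R := u (ray r).
Definition dprofile u (r : R) : R := partial i0 u (ray r).

Lemma radial_profile u x : radial u -> u x = profile u (enorm x).
Proof. by move=> ru; apply: ru; rewrite enorm_ray ?enorm_ge0. Qed.

Lemma is_derive_profile u r : derivable u (ray r) 'e_i0 ->
  is_derive r 1 (profile u) (dprofile u r).
Proof.
move=> du.
have -> : profile u = (fun s : R => u (s *: 'e_i0 + 0)).
  by apply/funext => s; rewrite addr0.
apply: (is_derive_line u 0 'e_i0 r (dprofile u r)).1.
by rewrite (addr0 (r *: 'e_i0)); apply: DeriveDef.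
Qed.

Lemma is_derive_enorm x i : x != 0 ->
  is_derive x 'e_i (@enorm R N) (x 0 i / enorm x).
Proof.
rewrite -enorm_gt0 => x0; apply/is_derive_line0.
have -> : (fun t : R => enorm (t *: 'e_i + x)) =
    Num.sqrt \o (fun t : R => enorm x ^+ 2 + (t ^+ 2 + (2 * x 0 i) * t)).
  apply/funext => t /=; congr Num.sqrt.
  rewrite sqr_enorm (bigD1 i)//= [in RHS](bigD1 i)//=.
  rewrite [X in _ + X = _](eq_bigr (fun j => x 0 j ^+ 2)).
    by rewrite !mxE !eqxx/=; ring.
  by move=> j /negPf ji; rewrite !mxE ji andbF mulr0 add0r.
pose S (t : R) : R := enorm x ^+ 2 + (t ^+ 2 + (2 * x 0 i) * t).
have dS : is_derive (0 : R) 1 S (2 * x 0 i).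
  have := @is_deriveX R R id 2 0 1 1 (is_derive_id (0 : R) 1).
  rewrite exprfctE => h.
  apply: (is_derive_eq (is_deriveD (is_derive_cst (enorm x ^+ 2) (0 : R) 1)
     (is_deriveD h (is_deriveZ (2 * x 0 i) (is_derive_id (0 : R) 1))))).
  by rewrite /GRing.scale/= expr1 !mulr0 mul0r !add0r mulr1.
have S0 : S 0 = enorm x ^+ 2 by rewrite /S expr0n mulr0 !addr0.
have dsq : is_derive (S 0) 1 Num.sqrt (2 * Num.sqrt (S 0))^-1.
  by apply: is_derive1_sqrt; rewrite S0 exprn_gt0.
apply: (is_derive_eq (is_derive1_comp dsq dS)).
rewrite S0 sqrtr_sqr ger0_norm ?(ltW x0)//.
by field; rewrite gt_eqF.
Qed.

Lemma partial_radial u x i : radial u ->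
  (forall r, 0 < r -> derivable u (ray r) 'e_i0) -> x != 0 ->
  is_derive x 'e_i u (dprofile u (enorm x) * (x 0 i / enorm x)).
Proof.
move=> ru du x0.
have x0' : 0 < enorm x by rewrite enorm_gt0.
rewrite [X in is_derive _ _ X _](_ : u = profile u \o @enorm R N); last first.
  by apply/funext => y; exact: radial_profile.
apply: is_derive_comp (is_derive_enorm i x0).
by apply: is_derive_profile; exact: du.
Qed.

(** The gradient is parallel to x: each partial derivative is the radial one times x_i / |x|. *)
Lemma enorm_gradient_radial u x : radial u ->
  (forall r, 0 < r -> derivable u (ray r) 'e_i0) -> x != 0 ->
  enorm (gradient u x) = `|dprofile u (enorm x)|.
Proof.
move=> ru du x0.
have x0' : 0 < enorm x by rewrite enorm_gt0.
have -> : gradient u x = (dprofile u (enorm x) / enorm x) *: x.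
  apply/rowP => i; rewrite !mxE /partial.
  by case: (partial_radial i ru du x0) => _ ->; ring.
by rewrite enormZ normrM normfV (gtr0_norm x0') mulfVK// gt_eqF.
Qed.

Lemma smooth_derivable u : smooth u -> forall x i, derivable u x 'e_i.
Proof. by move=> su x i; have [_] := su [::]; exact. Qed.

Lemma smooth_continuous u : smooth u -> continuous u.
Proof. by move=> su; have [] := su [::]. Qed.

Lemma smooth_partial_continuous u i : smooth u -> continuous (partial i u).
Proof. by move=> su; have [] := su [:: i]. Qed.

Lemma ray_continuous : continuous ray.
Proof. by move=> r; apply: cvgZr_tmp; exact: cvg_id. Qed.

Lemma dprofile_continuous u : smooth u -> continuous (dprofile u).
Proof.
move=> su r; apply: (@continuous_comp _ _ _ ray (partial i0 u)).
  exact: ray_continuous.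
exact: smooth_partial_continuous.
Qed.

Lemma ler_coord_norm x i : `|x 0 i| <= `|x|.
Proof.
rewrite [leRHS]/Num.norm/= mx_normrE.
exact: (le_bigmax _ (fun ij => `|x ij.1 ij.2|) (0, i)).
Qed.

Lemma Cc_bounded_support u : Cc_infty setT u ->
  exists2 M, 0 < M & forall x, M < enorm x -> u x = 0.
Proof.
move=> [_ /compact_bounded[M [_ Mu]] _].
have N0 : 0 < N%:R :> R by rewrite ltr0n; case: (N) (i0) => [[]|].
exists (N%:R * (`|M| + 1)); first by rewrite mulr_gt0// ltr_wpDl.
move=> x xM; apply/eqP; apply/negPn/negP => ux.
have : enorm x <= N%:R * (`|M| + 1).
  apply: ler_enorm_coord => [|i]; first by rewrite addr_ge0.
  have : `|x| <= `|M| + 1.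
    apply: (Mu (`|M| + 1)); first by rewrite (le_lt_trans (ler_norm _))// ltrDl.
    exact: subset_closure.
  by apply: le_trans; exact: ler_coord_norm.
by rewrite leNgt xM.
Qed.

Lemma measurable_energy_integrand (p : R) (A : R -> R) (g : 'rV[R]_N -> 'rV[R]_N) :
  (forall r, 0 < r -> {for r, continuous A}) ->
  (forall i, measurable_fun (punctured : set (@RN R N)) (fun x => g x 0 i)) ->
  measurable_fun (punctured : set (@RN R N))
    (fun x => (A (enorm x) * enorm (g x) `^ p)%:E).
Proof.
move=> cA mg; apply/measurable_EFinP; apply: measurable_funM.
  apply: (@measurable_comp_enorm _ _ A).
  apply: open_continuous_measurable_fun => // r.
  by rewrite inE/= in_itv/= andbT => /cA.
apply: (@measurableT_comp _ _ _ _ _ _ (fun y : R => y `^ p)).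
  exact: measurable_powR.
rewrite (_ : (fun x => _) =
   Num.sqrt \o (fun x : @RN R N => \sum_(i < N) g x 0 i ^+ 2)%R)//.
apply: measurableT_comp.
  by apply: continuous_measurable_fun; exact: sqrt_continuous.
by apply: measurable_sum => i; exact/measurable_funX/mg.
Qed.

Lemma measurable_gradient u i : smooth u ->
  measurable_fun [set: @RN R N] (fun x : @RN R N => gradient u x 0 i).
Proof.
move=> su; rewrite (_ : (fun x => _) = partial i u); last first.
  by apply/funext => x; rewrite mxE.
exact/continuous_measurable_RN/smooth_partial_continuous.
Qed.

Lemma energy_radial (p : R) (A : R -> R) u :
  (forall r, 0 < r -> {for r, continuous A}) ->
  radial u -> smooth u ->
  energy p A (gradient u) =
  (\int[mu]_(x in punctured) (A (enorm x) * `|dprofile u (enorm x)| `^ p)%:E)%E.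
Proof.
move=> cA ru su.
have N0 : (0 < N)%N by case: (N) (i0) => [[]|].
have m := @measurable_energy_integrand p A (gradient u) cA
  (fun i => measurable_funTS (measurable_gradient i su)).
rewrite /energy (integral_punctured N0 m).
apply: eq_integral => x; rewrite inE => /eqP x0.
by rewrite enorm_gradient_radial// => r r0; exact: smooth_derivable.
Qed.

End radial_functions.

(** * Power lower bounds on A *)

Section lower_bounds.
Context {R : realType}.
Implicit Types (A : R -> R) (a c : R).

(** Halving c makes the inequality strict, so the infimum over some set of the filter already
    exceeds c / 2. *)
Lemma limf_einf_lower (F : set_system R) (f : R -> R) c : Filter F -> 0 < c ->
  (c%:E <= limf_einf (fun r => (f r)%:E) F)%E -> \forall r \near F, c / 2 <= f r.
Proof.
move=> FF c0; rewrite limf_einfE => h.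
have : ((c / 2)%:E < ereal_sup [set ereal_inf ((fun r => (f r)%:E) @` V) | V in F])%E.
  by apply: lt_le_trans h; rewrite lte_fin; lra.
move=> /ereal_sup_gt[_ [V FV <-] cV].
apply: filterS FV => r Vr; rewrite -lee_fin.
by apply: (le_trans (ltW cV)); apply: ereal_inf_lbound; exists r.
Qed.

Lemma continuous_powR a r : 0 < r -> {for r, continuous (fun y : R => y `^ a)}.
Proof.
move=> r0; apply: differentiable_continuous; apply/derivable1_diffP.
by case: (is_derive1_powR a r0).
Qed.

Lemma segment_lower A a (s t : R) : 0 < s <= t ->
  (forall r, 0 < r -> 0 < A r) -> (forall r, 0 < r -> {for r, continuous A}) ->
  exists2 c, 0 < c & forall r, s <= r <= t -> c * r `^ a <= A r.
Proof.
move=> /andP[s0 st] A0 cA.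
pose f r := A r / r `^ a.
have cf : {within `[s, t], continuous f}.
  apply: continuous_in_subspaceT => r; rewrite inE/= in_itv/= => /andP[sr _].
  have r0 := lt_le_trans s0 sr.
  apply: cvgM; first exact: cA.
  apply: cvgV; first by rewrite gt_eqF ?powR_gt0.
  exact: continuous_powR.
have [m + mP] := EVT_min st cf.
rewrite in_itv/= => /andP[sm mt].
have m0 := lt_le_trans s0 sm.
exists (f m); first by rewrite divr_gt0 ?A0 ?powR_gt0.
move=> r rst; have /mP : r \in `[s, t] by rewrite in_itv.
have r0 : 0 < r by case/andP: rst => sr _; exact: lt_le_trans sr.
by rewrite {2}/f ler_pdivlMr ?powR_gt0.
Qed.

(** The lower limit gives the bound on some ]0, s[, with half the constant; on the compact interval
    [s, 1] the positive continuous quotient A(r) / r^a attains its minimum. *)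
Lemma near0_lower A a c : 0 < c ->
  (forall r, 0 < r -> 0 < A r) -> (forall r, 0 < r -> {for r, continuous A}) ->
  (c%:E <= limf_einf (fun r => (A r / r `^ a)%:E) 0^'+)%E ->
  exists2 c', 0 < c' & forall r, 0 < r <= 1 -> c' * r `^ a <= A r.
Proof.
move=> c0 A0 cA /(limf_einf_lower _ c0) H.
have [d /= d0 dP] := H.
pose s := Num.min 1 (d / 2).
have s0 : 0 < s by rewrite lt_min ltr01 divr_gt0.
have s1 : s <= 1 by rewrite ge_min lexx.
have [c1 c10 c1P] := @segment_lower A a s 1 (introT andP (conj s0 s1)) A0 cA.
exists (Num.min c1 (c / 2)); first by rewrite lt_min c10 divr_gt0.
move=> r /andP[r0 r1]; have [sr|rs] := leP s r.
  apply: (@le_trans _ _ (c1 * r `^ a)); last by rewrite c1P// sr.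
  by rewrite ler_wpM2r ?powR_ge0// ge_min lexx.
apply: (@le_trans _ _ (c / 2 * r `^ a)).
  by rewrite ler_wpM2r ?powR_ge0// ge_min lexx orbT.
rewrite -ler_pdivlMr ?powR_gt0//; apply: dP => //=.
rewrite sub0r normrN gtr0_norm//.
by move: rs; rewrite lt_min => /andP[_]; lra.
Qed.

Lemma nearoo_lower A a c : 0 < c ->
  (forall r, 0 < r -> 0 < A r) -> (forall r, 0 < r -> {for r, continuous A}) ->
  (c%:E <= limf_einf (fun r => (A r / r `^ a)%:E) +oo%R)%E ->
  exists2 c', 0 < c' & forall r, 1 <= r -> c' * r `^ a <= A r.
Proof.
move=> c0 A0 cA /(limf_einf_lower _ c0) H.
have [d [_ dP]] := H.
pose t := Num.max 1 (d + 1).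
have t1 : 1 <= t by rewrite le_max lexx.
have [c1 c10 c1P] := @segment_lower A a 1 t (introT andP (conj ltr01 t1)) A0 cA.
exists (Num.min c1 (c / 2)); first by rewrite lt_min c10 divr_gt0.
move=> r r1; have r0 : 0 < r by rewrite (lt_le_trans _ r1).
have [rt|tr] := leP r t.
  apply: (@le_trans _ _ (c1 * r `^ a)); last by rewrite c1P// r1.
  by rewrite ler_wpM2r ?powR_ge0// ge_min lexx.
apply: (@le_trans _ _ (c / 2 * r `^ a)).
  by rewrite ler_wpM2r ?powR_ge0// ge_min lexx orbT.
rewrite -ler_pdivlMr ?powR_gt0//; apply: dP.
by move: tr; rewrite gt_max => /andP[_]; lra.
Qed.

End lower_bounds.

Section radial_bound.
Context {R : realType} {N : nat}.
Variable i0 : 'I_N.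
Let N0 : (0 < N)%N. Proof. by case: (N) (i0) => [[]|]. Qed.
Local Notation mu := (@lebesgueN R N).
Variables (p a0 aoo c0 coo : R) (A : R -> R).
Hypotheses (p1 : 1 < p) (pNa0 : p - N%:R < a0) (pNaoo : p - N%:R < aoo).
Hypotheses (c0_gt0 : 0 < c0) (coo_gt0 : 0 < coo).
Hypothesis A_gt0 : forall r, 0 < r -> 0 < A r.
Hypothesis A_cont : forall r, 0 < r -> {for r, continuous A}.
Hypothesis A_low0 : forall r, 0 < r <= 1 -> c0 * r `^ a0 <= A r.
Hypothesis A_lowoo : forall r, 1 <= r -> coo * r `^ aoo <= A r.

Definition bound_cst (E : R) : R :=
  (E + @osc_cst R N p a0 c0) + (E + @osc_cst R N p aoo coo).

Lemma osc_cst_ge0 a c : p - N%:R < a -> 0 <= @osc_cst R N p a c.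
Proof.
move=> pNa; rewrite mulr_ge0 ?powR_ge0// invr_ge0 divr_ge0//; last first.
  by rewrite subr_ge0 ltW.
by move: pNa; rewrite -subr_gt0 => /ltW; congr (0 <= _); ring.
Qed.

(** Compact support anchors the function: it vanishes at some r1, so its oscillation between 1 and
    r1 bounds it on the unit sphere, uniformly in r1. The oscillation between |x| and 1 brings the
    weight |x|^(-nu), which is at least 1 and absorbs the first bound. The two summands of
    [bound_cst] are these two oscillations. *)
Lemma S_A_bound (E : R) (u : 'rV[R]_N -> R) (x : 'rV[R]_N) : S_A p A u ->
  (energy p A (gradient u) <= E%:E)%E -> 0 < enorm x <= 1 ->
  `|u x| <= enorm x `^ (- @decay R N p a0) * bound_cst E.
Proof.
move=> [Cu ru _]; have su : smooth u by case: Cu.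
rewrite (energy_radial i0)// => uE /andP[x0 x1].
have E0 : 0 <= E.
  rewrite -lee_fin; apply: le_trans uE; apply: integral_ge0 => y.
  by rewrite punctured_enorm => y0; rewrite lee_fin mulr_ge0 ?powR_ge0// ltW ?A_gt0.
have dP (r : R) : 0 < r -> is_derive r 1 (profile i0 u) (dprofile i0 u r).
  by move=> r0; apply: is_derive_profile; exact: smooth_derivable.
have cP (r : R) : 0 < r -> {for r, continuous (dprofile i0 u)}.
  by move=> _; exact: dprofile_continuous.
have [M M0 MP] := Cc_bounded_support i0 Cu.
pose r1 := Num.max 1 (M + 1).
have r11 : 1 <= r1 by rewrite le_max lexx.
have uM : profile i0 u r1 = 0.
  apply: MP; rewrite enorm_ray ?(le_trans ler01)//.
  by rewrite lt_max ltrDl ltr01 orbT.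
have := @oscillation R N N0 p a0 c0 p1 pNa0 c0_gt0 A _ _ A_gt0 A_cont dP cP E
  (enorm x) 1 uE.
rewrite x0 x1 => /(_ isT) H1.
have {}H1 := H1 (fun r h => A_low0 (introT andP
  (conj (lt_le_trans x0 (proj1 (andP h))) (proj2 (andP h))))).
have := @oscillation R N N0 p aoo coo p1 pNaoo coo_gt0 A _ _ A_gt0 A_cont dP cP E
  1 r1 uE.
rewrite r11 ltr01 => /(_ isT) H2.
have {}H2 := H2 (fun r h => A_lowoo (proj1 (andP h))).
rewrite powR1 mul1r uM sub0r normrN in H2.
rewrite (radial_profile i0 x ru).
have -> : profile i0 u (enorm x) =
  - (profile i0 u 1 - profile i0 u (enorm x)) + profile i0 u 1 by ring.
apply: (le_trans (ler_normD _ _)); rewrite normrN mulrDr; apply: lerD => //.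
apply: (le_trans H2); apply: ler_peMl.
  by rewrite addr_ge0// osc_cst_ge0.
rewrite [leLHS](_ : _ = 1 `^ (- @decay R N p a0)); last by rewrite powR1.
apply: ler_npowR; last by rewrite x0.
rewrite oppr_le0 divr_ge0//; last by rewrite ltW// (lt_trans _ p1).
by move: pNa0; rewrite -subr_gt0 => /ltW; congr (0 <= _); ring.
Qed.

End radial_bound.

(** * From S_A to its completion *)

Section enormD.
Context {R : realType} {N : nat}.
Implicit Types x y : 'rV[R]_N.

(** The value of the constant is immaterial; this one follows coordinatewise from (a + b)^2 <= 2 a^2
    + 2 b^2. *)
Lemma enormD_le x y : enorm (x + y) <= 2 * Num.max (enorm x) (enorm y).
Proof.
set m := Num.max _ _.
have m0 : 0 <= m by rewrite le_max enorm_ge0.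
rewrite -(@ler_pXn2r _ 2)// ?nnegrE ?enorm_ge0 ?mulr_ge0//.
apply: (@le_trans _ _ (2 * enorm x ^+ 2 + 2 * enorm y ^+ 2)).
  rewrite !sqr_enorm !mulr_sumr -big_split/=; apply: ler_sum => i _.
  rewrite mxE -subr_ge0 (_ : _ - _ = (x 0 i - y 0 i) ^+ 2) ?sqr_ge0//.
  by ring.
have xm : enorm x ^+ 2 <= m ^+ 2.
  by rewrite ler_pXn2r ?nnegrE ?enorm_ge0// le_max lexx.
have ym : enorm y ^+ 2 <= m ^+ 2.
  by rewrite ler_pXn2r ?nnegrE ?enorm_ge0// le_max lexx orbT.
by rewrite exprMn; lra.
Qed.

Lemma enormD_powR (p : R) x y : 0 < p ->
  enorm (x + y) `^ p <= 2 `^ p * (enorm x `^ p + enorm y `^ p).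
Proof.
move=> p0; set m := Num.max (enorm x) (enorm y).
have m0 : 0 <= m by rewrite le_max enorm_ge0.
apply: (@le_trans _ _ ((2 * m) `^ p)).
  apply: ge0_ler_powR; rewrite ?nnegrE ?(ltW p0) ?enorm_ge0 ?mulr_ge0//.
  exact: enormD_le.
rewrite powRM// ler_wpM2l ?powR_ge0// /m /Num.max.
by case: ifPn => _; rewrite ?lerDl ?lerDr powR_ge0.
Qed.

End enormD.

Section L1loc.
Context {R : realType} {N : nat}.
Hypothesis N0 : (0 < N)%N.
Local Notation mu := (@lebesgueN R N).

Definition annulus (a b : R) : set 'rV[R]_N := [set x | a <= enorm x <= b].

Lemma compact_annulus a b : compact (annulus a b).
Proof.
apply: bounded_closed_compact.
  exists `|b|; split => // M bM x /andP[_ xb].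
  have M0 : 0 <= M by rewrite ltW// (le_lt_trans _ bM).
  rewrite /= [leLHS]/Num.norm/= mx_normrE.
  apply/bigmax_leP; split => //= -[i j] _ /=.
  rewrite (ord1 i) (le_trans (ler_coord_enorm x j))// (le_trans xb)//.
  by rewrite (le_trans (ler_norm _))// ltW.
rewrite (_ : annulus a b = enorm @^-1` [set` `[a, b]]); last first.
  by apply/seteqP; split=> x; rewrite /annulus/= in_itv.
apply: closed_comp => [x _|]; first exact: enorm_continuous.
exact: itv_closed.
Qed.

Lemma annulus_punctured (a b : R) : 0 < a -> annulus a b `<=` punctured.
Proof.
by move=> a0; rewrite punctured_enorm => x /andP[ax _]; exact: lt_le_trans ax.
Qed.

(** The compact annuli 1/(n + 1) <= |x| <= n + 1 exhaust the punctured space. Members of [D_A] and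
    their gradients owe their measurability to local integrability. *)
Lemma L1loc_measurable (f : 'rV[R]_N -> R) : L1loc_on punctured f ->
  measurable_fun (punctured : set (@RN R N)) f.
Proof.
move=> lf.
have -> : punctured = \bigcup_n (annulus n.+1%:R^-1 n.+1%:R : set (@RN R N)).
  apply/seteqP; split=> x.
    rewrite punctured_enorm/= => x0.
    exists (maxn (Num.truncn (enorm x)) (Num.truncn (enorm x)^-1)) => //.
    rewrite /annulus/=; apply/andP; split.
      rewrite invf_ple ?posrE// ltW// (lt_le_trans (truncnS_gt _))// ler_nat ltnS.
      exact: leq_maxr.
    rewrite ltW// (lt_le_trans (truncnS_gt _))// ler_nat ltnS.
    exact: leq_maxl.
  by move=> [n _]; apply: annulus_punctured; rewrite invr_gt0.
apply/measurable_fun_bigcup => n.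
  by apply: compact_measurable_RN; exact: compact_annulus.
apply/measurable_EFinP; apply: (@measurable_int _ _ _ mu).
apply: lf; first exact: compact_annulus.
by apply: annulus_punctured; rewrite invr_gt0.
Qed.

End L1loc.

Section D_A_bound.
Context {R : realType} {N : nat}.
Variable i0 : 'I_N.
Let N0 : (0 < N)%N. Proof. by case: (N) (i0) => [[]|]. Qed.
Local Notation mu := (@lebesgueN R N).
Variables (p a0 aoo c0 coo : R) (A : R -> R).
Hypotheses (p1 : 1 < p) (pNa0 : p - N%:R < a0) (pNaoo : p - N%:R < aoo).
Hypotheses (c0_gt0 : 0 < c0) (coo_gt0 : 0 < coo).
Hypothesis A_gt0 : forall r, 0 < r -> 0 < A r.
Hypothesis A_cont : forall r, 0 < r -> {for r, continuous A}.
Hypothesis A_low0 : forall r, 0 < r <= 1 -> c0 * r `^ a0 <= A r.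
Hypothesis A_lowoo : forall r, 1 <= r -> coo * r `^ aoo <= A r.

Lemma energy_ge0 (g : 'rV[R]_N -> 'rV[R]_N) :
  (forall i, measurable_fun (punctured : set (@RN R N)) (fun x => g x 0 i)) ->
  (0 <= energy p A g)%E.
Proof.
move=> mg; rewrite /energy.
rewrite (integral_punctured N0 (measurable_energy_integrand p A_cont mg)).
apply: integral_ge0 => x; rewrite punctured_enorm => x0.
by rewrite lee_fin mulr_ge0 ?powR_ge0// ltW ?A_gt0.
Qed.

Lemma energyD_le (f g : 'rV[R]_N -> 'rV[R]_N) :
  (forall i, measurable_fun (punctured : set (@RN R N)) (fun x => f x 0 i)) ->
  (forall i, measurable_fun (punctured : set (@RN R N)) (fun x => g x 0 i)) ->
  (energy p A (fun x => f x + g x)%R <=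
   (2 `^ p)%:E * (energy p A f + energy p A g))%E.
Proof.
move=> mf mg.
have mfg i : measurable_fun (punctured : set (@RN R N)) (fun x => (f x + g x) 0 i).
  rewrite (_ : (fun x => _) = (fun x => f x 0 i + g x 0 i)); last first.
    by apply/funext => x; rewrite mxE.
  exact: measurable_funD.
have mP := @measurable_punctured R N.
have m1 := measurable_energy_integrand p A_cont mfg.
have m2 := measurable_energy_integrand p A_cont mf.
have m3 := measurable_energy_integrand p A_cont mg.
have pos (h : 'rV[R]_N -> 'rV[R]_N) x : punctured x ->
    (0 <= (A (enorm x) * enorm (h x) `^ p)%:E)%E.
  rewrite punctured_enorm => x0.
  by rewrite lee_fin mulr_ge0 ?powR_ge0// ltW ?A_gt0.
rewrite /energy (integral_punctured N0 m1) (integral_punctured N0 m2)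
  (integral_punctured N0 m3).
rewrite -(ge0_integralD _ mP (pos f) m2 (pos g) m3).
rewrite -(ge0_integralZl _ mP (emeasurable_funD m2 m3)); last 2 first.
- by move=> x x0; apply: adde_ge0; exact: pos.
- by rewrite lee_fin powR_ge0.
apply: ge0_le_integral.
- exact: mP.
- exact: pos.
- exact: m1.
- exact: (measurable_funeM _ (emeasurable_funD m2 m3)).
- move=> x; rewrite punctured_enorm/= => x0.
  rewrite -EFinD -EFinM lee_fin -mulrDr mulrCA.
  rewrite ler_wpM2l ?(ltW (A_gt0 x0))//.
  by apply: enormD_powR; exact: lt_trans p1.
Qed.

(** By the crude triangle inequality [energyD_le], the energy of [u_ n] is eventually at most 2^p (1
    + 1). One bound in S_A thus serves all large n and survives the almost everywhere limit. *)
Lemma D_A_bound (u : 'rV[R]_N -> R) g : D_A p A u g ->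
  (energy p A g <= 1)%E ->
  {ae mu, forall x, 0 < enorm x <= 1 -> `|u x| <= enorm x `^ (- @decay R N p a0) *
     @bound_cst R N p a0 aoo c0 coo (2 `^ p * 2)}.
Proof.
move=> [ru [_ lg _] [u_ [Su_ gu_ uu_]]] g1.
have mg i : measurable_fun (punctured : set (@RN R N)) (fun x => g x 0 i).
  exact: L1loc_measurable.
have en : \forall n \near \oo, (energy p A (gradient (u_ n)) <= (2 `^ p * 2)%:E)%E.
  have : \forall n \near \oo, (energy p A (fun x => gradient (u_ n) x - g x)%R < 1)%E.
    apply: (gu_ [set y | (y < 1)%E]).
    apply: open_nbhs_nbhs; split; first exact: open_ereal_lt_ereal.
    by rewrite /= lte_fin.
  apply: filterS => n n1.
  have mu_ i : measurable_fun (punctured : set (@RN R N))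
      (fun x => gradient (u_ n) x 0 i).
    apply: measurable_funTS; apply: measurable_gradient.
    by have [[]] := Su_ n.
  have mug i : measurable_fun (punctured : set (@RN R N))
      (fun x => (gradient (u_ n) x - g x) 0 i).
    rewrite (_ : (fun x => _) = (fun x => gradient (u_ n) x 0 i - g x 0 i)).
      exact: measurable_funB.
    by apply/funext => x; rewrite !mxE.
  have := energyD_le mug mg.
  rewrite (_ : (fun x => _) = gradient (u_ n)); last first.
    by apply/funext => x; rewrite subrK.
  move=> /le_trans; apply.
  rewrite EFinM; apply: lee_wpmul2l; first by rewrite lee_fin powR_ge0.
  exact: (leeD (ltW n1) g1).
move: uu_; apply: negligibleS => x /=; apply: contra_not => ux x01.
have nx : `|u_ n x| @[n --> \oo] --> `|u x| by apply: cvg_norm.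
apply: (cvgr_to_le nx).
apply: filterS en => n n1.
exact: (@S_A_bound R N i0 p a0 aoo c0 coo A p1 pNa0 pNaoo c0_gt0 coo_gt0 A_gt0
  A_cont A_low0 A_lowoo).
Qed.

End D_A_bound.

(** * Decay of S_0 *)

Section pointwise.
Context {R : realType}.

(** Both factors are bounded by powers of max(a, b) whose exponents add up to 1. *)
Lemma powR_young_le (a b beta : R) : 0 <= a -> 0 <= b -> 0 <= beta <= 1 ->
  a `^ beta * b `^ (1 - beta) <= a + b.
Proof.
move=> a0 b0 /andP[be0 be1].
pose m := Num.max a b.
have m0 : 0 <= m by rewrite le_max a0.
have am : a <= m by rewrite le_max lexx.
have bm : b <= m by rewrite le_max lexx orbT.
have mab : m <= a + b by rewrite /m /Num.max; case: ifPn; rewrite ?lerDl ?lerDr.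
apply: le_trans mab.
have be1' : 0 <= 1 - beta by rewrite subr_ge0.
apply: (@le_trans _ _ (m `^ beta * m `^ (1 - beta))).
  by apply: ler_pM; rewrite ?powR_ge0//; apply: ge0_ler_powR; rewrite ?nnegrE.
rewrite -powRD; last by rewrite addrC subrK oner_eq0.
by rewrite addrC subrK powRr1.
Qed.

(** Here |u|^q is split as (|u|^p)^beta |u|^(q - p beta). The first factor joins V^beta; the second
    is bounded by the decay of u. The exponent relation then rewrites the collected power of r as
    r^delta (r^tau)^(1 - beta), in the shape of [powR_young_le]. *)
Lemma weighted_bound (p q alpha beta nu tau delta L B K V u r : R) :
  0 < p -> 0 < q -> p * beta < q -> 0 <= beta <= 1 ->
  delta + tau * (1 - beta) = alpha - nu * (q - p * beta) ->
  0 <= L -> 0 <= B -> 0 < r -> 0 <= V ->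
  K <= L * (r `^ alpha * V `^ beta) -> `|u| <= r `^ (- nu) * B ->
  K * `|u| `^ q <=
    (L * B `^ (q - p * beta)) * r `^ delta * (V * `|u| `^ p + r `^ tau).
Proof.
move=> p0 q0 pq be dt L0 B0 r0 V0 KL uB.
have rn0 := gt_eqF r0.
(* The splitting of |u|^q adds exponents, which takes a nonzero base. *)
have [->|u0] := eqVneq u 0.
  rewrite normr0 powR0 ?gt_eqF// mulr0 !mulr_ge0 ?powR_ge0//.
  by rewrite addr_ge0 ?mulr_ge0 ?powR_ge0.
have u0' : 0 < `|u| by rewrite normr_gt0.
have qp0 : 0 <= q - p * beta by rewrite subr_ge0 ltW.
have uq : `|u| `^ q = (`|u| `^ p) `^ beta * `|u| `^ (q - p * beta).
  rewrite -powRrM -powRD ?(gt_eqF u0') ?implybT//; congr (_ `^ _); ring.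
have uqB : `|u| `^ (q - p * beta) <= r `^ (- nu * (q - p * beta)) * B `^ (q - p * beta).
  apply: (@le_trans _ _ ((r `^ (- nu) * B) `^ (q - p * beta))).
    by apply: ge0_ler_powR; rewrite ?nnegrE ?mulr_ge0 ?powR_ge0.
  by rewrite powRM ?powR_ge0// -powRrM.
have rr : r `^ alpha * r `^ (- nu * (q - p * beta)) =
    r `^ delta * (r `^ tau) `^ (1 - beta).
  rewrite -powRrM -!powRD ?rn0 ?implybT//; congr (_ `^ _).
  by rewrite dt mulNr.
have yg := @powR_young_le (V * `|u| `^ p) (r `^ tau) beta (mulr_ge0 V0 (powR_ge0 _ _))
  (powR_ge0 _ _) be.
rewrite powRM ?powR_ge0// in yg.
apply: (@le_trans _ _ (L * (r `^ alpha * V `^ beta) * `|u| `^ q)).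
  by rewrite ler_wpM2r ?powR_ge0.
rewrite uq.
apply: (@le_trans _ _ (L * (r `^ alpha * V `^ beta) * ((`|u| `^ p) `^ beta *
   (r `^ (- nu * (q - p * beta)) * B `^ (q - p * beta))))).
  apply: ler_wpM2l; first by rewrite !mulr_ge0 ?powR_ge0.
  by apply: ler_wpM2l => //; exact: powR_ge0.
have E1 (l x v y z w : R) : l * (x * v) * (y * (z * w)) = l * w * (x * z) * (v * y).
  by ring.
have E2 (a b c d e : R) : a * (b * c) * (d * e) = a * b * (d * e * c) by ring.
rewrite E1 rr E2.
by apply: ler_wpM2l yg; rewrite !mulr_ge0 ?powR_ge0.
Qed.

(** A finite bound excludes the value +oo, that is beta > 0 with V r = 0; in all other cases the
    denominator is positive, also for beta = 0 and V r = 0. *)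
Lemma KV_ratio_le (K V : R -> R) (alpha beta L r : R) : 0 <= beta ->
  0 < r -> 0 <= V r -> (KV_ratio K V alpha beta r <= L%:E)%E ->
  K r <= L * (r `^ alpha * V r `^ beta).
Proof.
move=> b0 r0 V0; rewrite /KV_ratio.
case: ifPn => [_|h]; first by rewrite leye_eq.
rewrite lee_fin ler_pdivrMr//.
apply: mulr_gt0; first exact: powR_gt0.
rewrite lt_neqAle powR_ge0 andbT eq_sym powR_eq0.
apply: contra h => /andP[-> bn0]; rewrite andbT.
by rewrite lt_neqAle eq_sym bn0.
Qed.

End pointwise.

Section main_estimate.
Context {R : realType} {N : nat}.
Variable i0 : 'I_N.
Let N0 : (0 < N)%N. Proof. by case: (N) (i0) => [[]|]. Qed.
Local Notation mu := (@lebesgueN R N).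
Local Notation cleb := (@completed_lebesgue_measure R).
Local Notation cara := (caratheodory_type ((wlength (@idfun R))^*)%mu).
Variables (p a0 aoo c0 coo : R) (A : R -> R).
Hypotheses (p1 : 1 < p) (pNa0 : p - N%:R < a0) (pNaoo : p - N%:R < aoo).
Hypotheses (c0_gt0 : 0 < c0) (coo_gt0 : 0 < coo).
Hypothesis A_gt0 : forall r, 0 < r -> 0 < A r.
Hypothesis A_cont : forall r, 0 < r -> {for r, continuous A}.
Hypothesis A_low0 : forall r, 0 < r <= 1 -> c0 * r `^ a0 <= A r.
Hypothesis A_lowoo : forall r, 1 <= r -> coo * r `^ aoo <= A r.
Variables (V K : R -> R).
Hypothesis V_ge0 : forall r, 0 < r -> 0 <= V r.
Hypothesis mV : measurable_fun (`]0, +oo[ : set cara) V.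
Hypothesis K_gt0 : forall r, 0 < r -> 0 < K r.
Hypothesis mK : measurable_fun (`]0, +oo[ : set cara) K.

Lemma measurable_weighted (W : R -> R) (u : 'rV[R]_N -> R) (q : R) :
  measurable_fun (`]0, +oo[ : set cara) W ->
  measurable_fun (punctured : set (@RN R N)) u ->
  measurable_fun (punctured : set (@RN R N)) (fun x => (W (enorm x) * `|u x| `^ q)%:E).
Proof.
move=> mW mu_; apply/measurable_EFinP; apply: measurable_funM.
  by apply: (@measurable_cara_comp_enorm _ _ N0 W).
apply: (@measurableT_comp _ _ _ _ _ _ (fun y : R => y `^ q)).
  exact: measurable_powR.
exact: measurableT_comp.
Qed.

Lemma integral_eball_punctured (rho : R) (f : @RN R N -> \bar R) :
  measurable_fun (punctured : set (@RN R N)) f ->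
  (\int[mu]_(x in eball rho) f x = \int[mu]_(x in punctured `&` eball rho) f x)%E.
Proof.
move=> mf; rewrite integral_mkcond (integral_punctured N0); last first.
  apply/measurable_restrict.
  - exact: measurable_eball.
  - exact: measurable_punctured.
  - by apply: measurable_funS mf; [exact: measurable_punctured|exact: subIsetl].
by rewrite integral_mkcondr.
Qed.

Lemma potentialE (u : 'rV[R]_N -> R) :
  measurable_fun (punctured : set (@RN R N)) u ->
  potential p V u =
  (\int[mu]_(x in punctured) (V (enorm x) * `|u x| `^ p)%:E)%E.
Proof.
by move=> mu_; rewrite /potential (integral_punctured N0 (measurable_weighted p mV mu_)).
Qed.

Lemma X_norm1_le (u : 'rV[R]_N -> R) (g : 'rV[R]_N -> 'rV[R]_N) : X p A V u g -> X_norm p A V u g = 1%E ->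
  (energy p A g <= 1)%E /\ (potential p V u <= 1)%E.
Proof.
move=> [[_ [lu lg _] _] _] n1.
have mu_ := L1loc_measurable lu.
have E0 : (0 <= energy p A g)%E.
  by apply: (energy_ge0 i0 p A_gt0 A_cont) => i; exact: L1loc_measurable.
have P0 : (0 <= potential p V u)%E.
  rewrite (potentialE mu_); apply: integral_ge0 => x; rewrite punctured_enorm => x0.
  by rewrite lee_fin mulr_ge0 ?powR_ge0// V_ge0.
have p0 : p^-1 != 0 by rewrite invr_eq0 gt_eqF// (lt_trans _ p1).
suff S1 : (energy p A g + potential p V u <= 1)%E.
  split; [exact: (le_trans (leeDl _ P0) S1)|exact: (le_trans (leeDr _ E0) S1)].
move: n1 (adde_ge0 E0 P0); rewrite /X_norm.
case: (_ + _)%E => [s| |]//=; last by rewrite (negbTE p0).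
(* A negative base has power 1 by default; nonnegativity of the sum rules that case out. *)
move=> [/eqP]; rewrite powR_eq1 (negbTE p0) orbF => /orP[/eqP->//|s0].
by rewrite lee_fin leNgt s0.
Qed.

Variables (R1 alpha beta Lam q : R).
Hypothesis beta01 : 0 <= beta <= 1.
Hypothesis Lam0 : 0 <= Lam.
Hypothesis KV : {ae cleb, forall r, 0 < r < R1 ->
  (KV_ratio K V alpha beta r <= Lam%:E)%E}.
Hypotheses (q1 : 1 < q) (pbq : p * beta < q).

Let nu : R := @decay R N p a0.
Let B : R := @bound_cst R N p a0 aoo c0 coo (2 `^ p * 2).
Let Ctot : R := Lam * B `^ (q - p * beta).

(** Integrates [weighted_bound]: on the ball r^delta <= rho^delta, the term V |u|^p contributes at
    most 1 by normalisation, and the integral of |x|^tau is enlarged to the unit ball to make it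
    independent of rho. *)
Lemma integral_KuX_le (tau delta rho : R) (u : 'rV[R]_N -> R)
    (g : 'rV[R]_N -> 'rV[R]_N) :
  delta + tau * (1 - beta) = alpha - nu * (q - p * beta) ->
  0 < delta -> 0 < rho <= 1 -> rho <= R1 ->
  X p A V u g -> X_norm p A V u g = 1%E ->
  (\int[mu]_(x in eball rho) (K (enorm x) * `|u x| `^ q)%:E <=
   (Ctot * rho `^ delta)%:E *
   (1 + \int[mu]_(x in [set x | (0 < enorm x <= 1)%R]) (enorm x `^ tau)%:E))%E.
Proof.
move=> dt d0 /andP[rho0 rho1] rhoR1 Xu n1.
have [E1 P1] := X_norm1_le Xu n1.
have [[_ [lu _ _] _] _] := Xu.
have mu_ := L1loc_measurable lu.
have DA : D_A p A u g by case: Xu.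
have ub := @D_A_bound R N i0 p a0 aoo c0 coo A p1 pNa0 pNaoo c0_gt0 coo_gt0 A_gt0
  A_cont A_low0 A_lowoo u g DA E1.
have B0 : 0 <= B.
  have T0 : 0 <= 2 `^ p * 2 :> R by rewrite mulr_ge0 ?powR_ge0.
  by apply: addr_ge0; apply: addr_ge0 => //; exact: osc_cst_ge0.
have mKu := measurable_weighted q mK mu_.
have mVu := measurable_weighted p mV mu_.
pose D : set (@RN R N) := punctured `&` eball rho.
have mD : measurable D.
  by apply: measurableI; [exact: measurable_punctured|exact: measurable_eball].
have DP x : D x -> 0 < enorm x < rho.
  by rewrite /D punctured_enorm /eball => -[/= -> ->].
rewrite (integral_eball_punctured rho mKu) -/D.
have mtau : measurable_fun (punctured : set (@RN R N)) (fun x => (enorm x `^ tau)%:E).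
  apply/measurable_EFinP; apply: (@measurable_comp_enorm _ _ (fun r => r `^ tau)).
  by apply: measurable_funTS; exact: measurable_powR.
have DS : D `<=` punctured by exact: subIsetl.
have mDKu := measurable_funS (@measurable_punctured R N) DS mKu.
have mDVu := measurable_funS (@measurable_punctured R N) DS mVu.
have mDtau := measurable_funS (@measurable_punctured R N) DS mtau.
have C0 : 0 <= Ctot * rho `^ delta by rewrite !mulr_ge0 ?powR_ge0.
have Vu0 x : D x -> (0 <= (V (enorm x) * `|u x| `^ p)%:E)%E.
  by move=> /DP/andP[x0 _]; rewrite lee_fin mulr_ge0 ?powR_ge0// V_ge0.
have t0 (x : @RN R N) : D x -> (0 <= (enorm x `^ tau)%:E)%E.
  by rewrite lee_fin powR_ge0.
apply: (@le_trans _ _ (\int[mu]_(x in D) ((Ctot * rho `^ delta)%:E *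
   ((V (enorm x) * `|u x| `^ p)%:E + (enorm x `^ tau)%:E)))%E).
  apply: ae_ge0_le_integral.
  - exact: mD.
  - by move=> x /DP/andP[x0 _]; rewrite lee_fin mulr_ge0 ?powR_ge0// ltW ?K_gt0.
  - exact: mDKu.
  - move=> x Dx; apply: mule_ge0; first by rewrite lee_fin.
    by apply: adde_ge0; [exact: Vu0|exact: t0].
  - exact: (measurable_funeM _ (emeasurable_funD mDVu mDtau)).
  (* The exceptional set joins two null sets: the points where the decay of u fails and those whose
     radius violates the bound on K. *)
  - move: (negligibleU ub (ae_enorm N0 KV)); apply: negligibleS => x /= /not_implyP[Dx].
    have /andP[x0 xr] := DP x Dx.
    move=> nle; apply: contrapT => /not_orP[/contrapT H1 /contrapT H2].
    apply: nle.
    have /H1 {}H1 : 0 < enorm x <= 1 by rewrite x0 ltW// (lt_le_trans xr).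
    have xn0 : x != 0 by rewrite -enorm_gt0.
    have /H2 {}H2 : x != 0 by [].
    have {}H2 : (KV_ratio K V alpha beta (enorm x) <= Lam%:E)%E.
      by apply: H2; rewrite x0 (lt_le_trans xr).
    have KL := KV_ratio_le (proj1 (andP beta01)) x0 (V_ge0 x0) H2.
    rewrite -EFinD -EFinM lee_fin.
    apply: (le_trans (weighted_bound (lt_trans ltr01 p1) (lt_trans ltr01 q1) pbq
      beta01 dt Lam0 B0 x0 (V_ge0 x0) KL H1)).
    apply: ler_wpM2r; first by rewrite addr_ge0 ?mulr_ge0 ?powR_ge0 ?V_ge0.
    apply: ler_wpM2l; first by rewrite mulr_ge0 ?powR_ge0.
    by apply: ge0_ler_powR; rewrite ?nnegrE ?(ltW d0) ?(ltW x0) ?(ltW rho0) ?(ltW xr).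
rewrite (ge0_integralZl _ mD (emeasurable_funD mDVu mDtau)); last 2 first.
- by move=> x Dx; apply: adde_ge0; [exact: Vu0|exact: t0].
- by rewrite lee_fin.
apply: lee_wpmul2l; first by rewrite lee_fin.
rewrite (ge0_integralD _ mD Vu0 mDVu t0 mDtau); apply: leeD.
  apply: le_trans P1; rewrite (potentialE mu_).
  apply: ge0_subset_integral.
  - exact: mD.
  - exact: measurable_punctured.
  - exact: mVu.
  - move=> x; rewrite punctured_enorm => x0.
    by rewrite lee_fin mulr_ge0 ?powR_ge0// V_ge0.
  - exact: DS.
apply: ge0_subset_integral.
- exact: mD.
- exact: (@measurable_shell R N 0 1).
- apply: measurable_funS mtau; first exact: measurable_punctured.
  by rewrite punctured_enorm => x /andP[].
- by move=> x _; rewrite lee_fin powR_ge0.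
- by move=> x /DP/andP[x0 xr] /=; rewrite x0 ltW// (lt_le_trans xr).
Qed.

Hypothesis q_lt : q < q_star N p a0 alpha beta.

Lemma S_0_le : exists C delta, [/\ 0 <= C, 0 < delta &
  forall rho, 0 < rho <= 1 -> rho <= R1 ->
    (@S_0 R N p A V K q rho <= (C * rho `^ delta)%:E)%E].
Proof.
have D0 : 0 < N%:R - p + a0.
  by move: pNa0; rewrite -subr_gt0; congr (0 < _); ring.
have p0 : 0 < p by exact: lt_trans p1.
have /andP[be0 be1] := beta01.
(* The value that delta would take at tau = -N; multiplied out, s > 0 is the hypothesis q <
   [q_star]. *)
pose s := alpha - nu * (q - p * beta) + N%:R * (1 - beta).
have s0 : 0 < s.
  have : nu * q < alpha - p * beta + N%:R + a0 * beta.
    move: q_lt; rewrite /q_star /nu /decay mulrCA mulrA mulrC.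
    by rewrite ltr_pdivlMl// mulrAC ltr_pdivrMr.
  have : nu * (p * beta) = (N%:R - p + a0) * beta.
    by rewrite /nu /decay; field; rewrite gt_eqF.
  by rewrite /s mulrBr => ->; lra.
(* The excess of tau over -N: e <= N keeps tau <= 0, and e <= s / 2 leaves delta >= s / 2. *)
pose e := Num.min N%:R (s / 2).
have NR0 : 0 < N%:R :> R by rewrite ltr0n.
have e0 : 0 < e by rewrite lt_min NR0 divr_gt0.
have eN : e <= N%:R by rewrite ge_min lexx.
have es : e <= s / 2 by rewrite ge_min lexx orbT.
pose tau := - N%:R + e.
pose delta := s - e * (1 - beta).
have d0 : 0 < delta.
  have : e * (1 - beta) <= e by rewrite ler_piMr ?(ltW e0)// gerBl.
  by rewrite /delta; lra.
have dt : delta + tau * (1 - beta) = alpha - nu * (q - p * beta).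
  by rewrite /delta /tau /s; ring.
have tau1 : - N%:R < tau <= 0.
  by rewrite /tau ltrDl e0 addrC subr_le0.
have := integral_powR_enorm_lty N0 tau1.
set I := (\int[mu]_(x in _) _)%E => Ioo.
have I0 : (0 <= I)%E by apply: integral_ge0 => x _; rewrite lee_fin powR_ge0.
have Ifin : I = (fine I)%:E by rewrite fineK// ge0_fin_numE.
have B0 : 0 <= Ctot by rewrite mulr_ge0 ?powR_ge0.
exists (Ctot * (1 + fine I)), delta; split => //.
  by rewrite mulr_ge0// addr_ge0// fine_ge0.
move=> rho rho01 rhoR1; apply: ge_ereal_sup => _ [[u g] [Xu n1] <-] /=.
apply: (le_trans (integral_KuX_le dt d0 rho01 rhoR1 Xu n1)).
by rewrite -/I Ifin -EFinD -EFinM lee_fin mulrAC.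
Qed.

End main_estimate.

(** * Nonemptiness of the unit sphere of X *)

Section flat.
Context {R : realType}.

(* The factor t^-k makes the family stable under derivation. *)
Definition flat (k : nat) (t : R) : R :=
  if 0 < t then t^-1 ^+ k * expR (- t^-1) else 0.

Lemma flat_le0 k t : t <= 0 -> flat k t = 0.
Proof. by rewrite /flat ltNge => ->. Qed.

Lemma flat_gt0 k t : 0 < t -> 0 < flat k t.
Proof.
by move=> t0; rewrite /flat t0 mulr_gt0 ?expR_gt0// exprn_gt0// invr_gt0.
Qed.

(** From exp(y) >= y^(k+2) / (k+2)! at y = 1/t. A quadratic bound yields the derivative 0 at the
    origin. *)
Lemma flat_le_sqr k t : `|flat k t| <= (k.+2)`!%:R * t ^+ 2.
Proof.
have [t0|t0] := ltP 0 t; last first.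
  by rewrite flat_le0// normr0 mulr_ge0 ?sqr_ge0.
rewrite gtr0_norm ?flat_gt0// /flat t0 expRN.
have ti0 : 0 < t^-1 by rewrite invr_gt0.
rewrite ler_pdivrMr ?expR_gt0// mulrAC -ler_pdivrMr ?exprn_gt0//.
have h := expR_ge1Dxn k.+1 (ltW ti0).
have f0 : 0 < (k.+2)`!%:R :> R by rewrite ltr0n fact_gt0.
rewrite -exprVn -exprD addn2 -ler_pdivrMl// mulrC.
by apply: le_trans h; rewrite lerDr.
Qed.

Lemma is_derive_flat k (t : R) :
  is_derive t 1 (flat k) (- k%:R * flat k.+1 t + flat k.+2 t).
Proof.
have [t0|t0|->] := ltgtP t 0.
- rewrite !flat_le0 ?(ltW t0)// mulr0 addr0.
  apply: (near_eq_is_derive (f := cst 0)).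
  near=> s; rewrite flat_le0// ltW//.
  by near: s; exact: lt_nbhsl.
- pose w (s : R) := s ^+ k * expR (- s).
  have dw (s : R) : is_derive s 1 w (k%:R * s ^+ k.-1 * expR (- s) - s ^+ k * expR (- s)).
    have d1 : is_derive s 1 (fun s : R => s ^+ k) (k%:R * s ^+ k.-1).
      have := @is_deriveX R R id k s 1 1 (is_derive_id s 1).
      by rewrite exprfctE => h; apply: (is_derive_eq h); rewrite [LHS]mulr1.
    have d2 : is_derive s 1 (fun s : R => expR (- s)) (expR (- s) * -1).
      exact: (@is_derive1_comp R expR -%R s _ _ (is_derive_expR (- s))
        (is_deriveNid s 1)).
    apply: (is_derive_eq (is_deriveM d1 d2)).
    by rewrite /GRing.scale/=; ring.
  have tn0 : t != 0 by rewrite gt_eqF.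
  have dv : is_derive t 1 (fun s : R => s^-1) (- t ^- 2).
    apply: (is_derive_eq (@is_deriveV R id t 1 1 tn0 (is_derive_id t 1))).
    by rewrite [LHS]mulr1.
  have := @is_derive1_comp R w (fun s : R => s^-1) t _ _ (dw t^-1) dv.
  move=> d; apply: (near_eq_is_derive (f := w \o (fun s : R => s^-1))).
    near=> s; have s0 : 0 < s by near: s; exact: lt_nbhsr.
    by rewrite /flat s0.
  apply: (is_derive_eq d).
  rewrite /flat t0 -exprVn.
  case: (k) => [|m]; first by rewrite expr0 !mul0r !mul1r; ring.
  by rewrite [m.+1.-1]/= !exprS; ring.
- rewrite !flat_le0// mulr0 addr0.
  (* By [flat_le_sqr] the difference quotient at 0 is at most (k+2)! |h|. *)
  have L : h^-1 *: ((flat k \o shift 0) (h *: 1) - flat k 0) @[h --> (0 : R)^'] --> (0 : R).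
    apply/cvgr0Pnorm_le => e e0.
    pose C : R := (k.+2)`!%:R.
    have C0 : 0 < C by rewrite ltr0n fact_gt0.
    near=> h.
    have h0 : h != 0 by near: h; exact: nbhs_dnbhs_neq.
    have he : `|h| < e / C by near: h; apply: dnbhs0_lt; rewrite divr_gt0.
    rewrite /= addr0 (flat_le0 _ (lexx 0)) subr0 [h *: 1]mulr1 normrM normfV.
    rewrite ler_pdivrMl ?normr_gt0//.
    apply: (le_trans (flat_le_sqr k h)).
    rewrite -real_normK ?num_real// expr2 mulrCA ler_pM2l ?normr_gt0//.
    by rewrite -ler_pdivlMl// mulrC ltW.
  apply: DeriveDef; last exact: cvg_lim L.
  by apply/cvg_ex; exists 0.
Unshelve. all: by end_near. Qed.

Lemma flat_continuous k : continuous (flat k).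
Proof.
move=> t; apply: differentiable_continuous; apply/derivable1_diffP.
by case: (is_derive_flat k t).
Qed.

End flat.

Section smooth_class.
Context {R : realType} {N : nat}.
Local Notation E := 'rV[R]_N.

(* Stability under partial derivatives gives smoothness without computing
   derivatives of higher order. *)
Inductive flatpoly : (E -> R) -> Prop :=
| flatpoly_cst c : flatpoly (fun=> c)
| flatpoly_coord i : flatpoly (fun x => x 0 i)
| flatpoly_add f g : flatpoly f -> flatpoly g -> flatpoly (fun x => f x + g x)
| flatpoly_mul f g : flatpoly f -> flatpoly g -> flatpoly (fun x => f x * g x)
| flatpoly_flat k f : flatpoly f -> flatpoly (flat k \o f).

Lemma flatpoly_continuous f : flatpoly f -> continuous f.
Proof.
elim=> [c|i|{}f g _ cf _ cg|{}f g _ cf _ cg|k {}f _ cf] x.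
- exact: cst_continuous.
- exact: coord_continuous.
- exact: (cvgD (cf x) (cg x)).
- exact: (cvgM (cf x) (cg x)).
- by apply: continuous_comp; [exact: cf|exact: flat_continuous].
Qed.

Lemma flatpoly_derive f i : flatpoly f ->
  exists2 g, flatpoly g & forall x, is_derive x 'e_i f (g x).
Proof.
elim=> [c|j|{}f g _ [df Gf dfP] _ [dg Gg dgP]|{}f g Hf [df Gf dfP] Hg [dg Gg dgP]
  |k {}f Hf [df Gf dfP]].
- exists (fun=> 0); first exact: flatpoly_cst.
  by move=> x; exact: is_derive_cst.
- exists (fun=> ('e_i : E) 0 j); first exact: flatpoly_cst.
  move=> x; apply/is_derive_line0.
  have -> : (fun t : R => (t *: 'e_i + x) 0 j) =
      (fun t : R => ('e_i : E) 0 j *: t + x 0 j).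
    by apply/funext => t; rewrite !mxE [RHS]addrC mulrC addrC.
  apply: (is_derive_eq (is_deriveD (is_deriveZ (('e_i : E) 0 j)
    (is_derive_id (0 : R) 1)) (is_derive_cst (x 0 j) (0 : R) 1))).
  by rewrite addr0 [LHS]mulr1.
- exists (fun x => df x + dg x); first exact: flatpoly_add.
  by move=> x; exact: is_deriveD.
- exists (fun x => f x * dg x + g x * df x).
    by apply: flatpoly_add; apply: flatpoly_mul.
  by move=> x; exact: is_deriveM.
- exists (fun x => (- k%:R * (flat k.+1 \o f) x + (flat k.+2 \o f) x) * df x).
    apply: (@flatpoly_mul (fun x => _ + _)) => //.
    apply: (@flatpoly_add (fun x => _ * _)); last exact: flatpoly_flat.
    by apply: (@flatpoly_mul (fun=> _)); [exact: flatpoly_cst|exact: flatpoly_flat].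
  by move=> x; apply: is_derive_comp; exact: is_derive_flat.
Qed.

Lemma flatpoly_partial f i : flatpoly f -> flatpoly (partial i f).
Proof.
move=> /(flatpoly_derive i)[g Gg dP].
rewrite (_ : partial i f = g)//; apply/funext => x.
by rewrite /partial; case: (dP x).
Qed.

Lemma flatpoly_smooth f : flatpoly f -> smooth f.
Proof.
move=> Gf s.
have Gs : flatpoly (iter_partial s f).
  by elim: s => //= i s IH; exact: flatpoly_partial.
split; first exact: flatpoly_continuous.
by move=> i x; have [g _ dP] := flatpoly_derive i Gs; case: (dP x).
Qed.

Lemma flatpoly_sum (r : seq 'I_N) (F : 'I_N -> E -> R) :
  (forall i, flatpoly (F i)) -> flatpoly (fun x => \sum_(i <- r) F i x).
Proof.
move=> GF; elim: r => [|i r IH].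
  rewrite (_ : (fun x => _) = fun=> 0); first exact: flatpoly_cst.
  by apply/funext => x; rewrite big_nil.
rewrite (_ : (fun x => _) = fun x => F i x + \sum_(j <- r) F j x).
  exact: flatpoly_add.
by apply/funext => x; rewrite big_cons.
Qed.

Lemma flatpoly_enorm_sqr : flatpoly (fun x => enorm x ^+ 2).
Proof.
rewrite (_ : (fun x => _) = fun x : E => \sum_(i < N) x 0 i * x 0 i).
  by apply: flatpoly_sum => i; apply: flatpoly_mul; exact: flatpoly_coord.
by apply/funext => x; rewrite sqr_enorm.
Qed.

(** The squared norm keeps the arguments of [flat] polynomial, hence smooth at the origin as well;
    both factors are positive exactly for 1/2 < |x| < 1. *)
Definition annular_bump (c : R) (x : E) : R :=
  c * (flat 0 (enorm x ^+ 2 - 4^-1) * flat 0 (1 - enorm x ^+ 2)).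

Lemma flatpoly_bump c : flatpoly (annular_bump c).
Proof.
apply: (@flatpoly_mul (fun=> c)); first exact: flatpoly_cst.
apply: (@flatpoly_mul (flat 0 \o (fun x => enorm x ^+ 2 + - 4^-1))
  (flat 0 \o (fun x => 1 - enorm x ^+ 2))).
  apply: flatpoly_flat; apply: flatpoly_add; last exact: flatpoly_cst.
  exact: flatpoly_enorm_sqr.
rewrite (_ : (fun x => _) = (fun x : E => 1 + -1 * enorm x ^+ 2)); last first.
  by apply/funext => x; rewrite mulN1r.
apply: flatpoly_flat; apply: (@flatpoly_add (fun=> 1)); first exact: flatpoly_cst.
apply: (@flatpoly_mul (fun=> -1)); first exact: flatpoly_cst.
exact: flatpoly_enorm_sqr.
Qed.

Let half_sqr : 4^-1 = 2^-1 ^+ 2 :> R. Proof. by field. Qed.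

Lemma bump_annulus c x : annular_bump c x != 0 -> 2^-1 < enorm x < 1.
Proof.
have [x1|x1] := leP (enorm x ^+ 2) 4^-1.
  by rewrite /annular_bump flat_le0 ?subr_le0// mul0r mulr0 eqxx.
have [x2|x2] := leP 1 (enorm x ^+ 2).
  by rewrite /annular_bump (flat_le0 _ (t := 1 - _)) ?subr_le0// !mulr0 eqxx.
move=> _; apply/andP; split.
  by rewrite -(@ltr_pXn2r _ 2) ?nnegrE ?enorm_ge0// -half_sqr.
by rewrite -(@ltr_pXn2r _ 2) ?nnegrE ?enorm_ge0// expr1n.
Qed.

Lemma bumpZ c x : annular_bump c x = c * annular_bump 1 x.
Proof. by rewrite /annular_bump mul1r. Qed.

Lemma bump1_gt0 x : 2^-1 < enorm x < 1 -> 0 < annular_bump 1 x.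
Proof.
move=> /andP[x1 x2].
rewrite /annular_bump mul1r mulr_gt0// flat_gt0// subr_gt0.
  by rewrite half_sqr ltr_pXn2r ?nnegrE ?enorm_ge0.
by rewrite expr_lt1 ?enorm_ge0.
Qed.

Lemma radial_bump c : radial (annular_bump c).
Proof. by move=> x y xy; rewrite /annular_bump xy. Qed.

Lemma supp_bump c : supp (annular_bump c) `<=` annulus 2^-1 1.
Proof.
have cl : closed (annulus 2^-1 1 : set E).
  by apply: compact_closed => //; exact: compact_annulus.
move=> x cx; apply: cl; apply: closureS cx => y /= /bump_annulus/andP[y1 y2].
by rewrite /annulus/= !ltW.
Qed.

Lemma Cc_infty_bump c : Cc_infty setT (annular_bump c).
Proof.
split => //; first exact/flatpoly_smooth/flatpoly_bump.
apply: subclosed_compact (@supp_bump c); first exact: closed_closure.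
exact: compact_annulus.
Qed.

End smooth_class.

(** * Translation invariance and integration by parts *)

Section translation.
Context {R : realType} {N : nat}.
Local Notation mu := (@lebesgueN R N).
Local Notation lout := (@lebesgue_outer R N).
Implicit Types (h : 'rV[R]_N).

Definition translate h (x : @RN R N) : @RN R N := x + h.

Lemma lebesgue_outer_translate h (E : set 'rV[R]_N) :
  lout (translate h @^-1` E) = lout E.
Proof.
rewrite -[RHS](lebesgue_outer_affine h E ltr01) expr1n mul1e; congr lebesgue_outer.
by apply/seteqP; split=> x; rewrite /translate/= scale1r.
Qed.

Lemma measurable_translate h : measurable_fun [set: @RN R N] (translate h).
Proof.
move=> _ E mE; rewrite setTI.
suff : lout.-caratheodory (translate h @^-1` E) by [].
move=> X; have XE : X = translate h @^-1` (translate (- h) @^-1` X).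
  by apply/seteqP; split=> x; rewrite /translate/= addrK.
rewrite XE preimage_setC -!preimage_setI.
by rewrite !(lebesgue_outer_translate h); exact: mE.
Qed.

Lemma integral_translate h (f : @RN R N -> R) :
  measurable_fun [set: @RN R N] f ->
  mu.-integrable setT (EFin \o f \o translate h) ->
  (\int[mu]_x (f (translate h x))%:E = \int[mu]_x (f x)%:E)%E.
Proof.
move=> mf intf.
have mf' : measurable_fun [set: @RN R N] (EFin \o f) by exact/measurable_EFinP.
have := @integral_pushforward _ _ _ _ R (translate h) (measurable_translate h) mu
  setT (EFin \o f) mf'.
rewrite preimage_setT => /(_ intf measurableT) /= <-.
apply: eq_measure_integral => [|mt A mA _]; first exact: measurable_translate.
exact: (lebesgue_outer_translate h A).
Qed.

End translation.

Lemma compact_bounded_image {R : realType} {T : topologicalType} (f : T -> R)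
    (C : set T) : {within C, continuous f} -> compact C ->
  exists2 B, 0 <= B & forall x, C x -> `|f x| <= B.
Proof.
move=> cf cC.
have /compact_bounded[B [_ Bf]] : compact (f @` C) by exact: continuous_compact.
exists (`|B| + 1); first by rewrite addr_ge0.
move=> x Cx; apply: (Bf (`|B| + 1)); last by exists x.
by rewrite (le_lt_trans (ler_norm _))// ltrDl.
Qed.

Section bounded_support.
Context {R : realType} {N : nat}.
Local Notation mu := (@lebesgueN R N).
Implicit Types (f u phi : 'rV[R]_N -> R).

Lemma compact_euclidean_ball M : compact (cball M : set 'rV[R]_N).
Proof.
rewrite (_ : cball M = annulus 0 M); first exact: compact_annulus.
by apply/seteqP; split=> x; rewrite /cball/annulus/= enorm_ge0.
Qed.

Lemma integrable_compact f (C : set 'rV[R]_N) : continuous f -> compact C ->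
  mu.-integrable C (EFin \o f).
Proof.
move=> cf cC.
have mC := compact_measurable_RN cC.
apply: measurable_bounded_integrable => //.
- have [B B0 BC] := compact_bounded_image (continuous_subspaceT (@enorm_continuous R N)) cC.
  apply: (le_lt_trans _ (lebesgueN_cball_lty B)).
  apply: lebesgueN_le => x /BC; rewrite /cball/=.
  by rewrite ger0_norm ?enorm_ge0.
- exact/measurable_funTS/continuous_measurable_RN.
- have [B B0 BC] := compact_bounded_image (continuous_subspaceT cf) cC.
  exists B; split; first exact: num_real.
  by move=> M BM x Cx; exact: le_trans (BC _ Cx) (ltW BM).
Qed.

Lemma integrable_bounded_support f M : continuous f ->
  (forall x, M < enorm x -> f x = 0) -> mu.-integrable setT (EFin \o f).
Proof.
move=> cf f0.
have mB : measurable (cball M : set (@RN R N)) by exact: measurable_cball.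
have := integrable_compact cf (@compact_euclidean_ball M).
rewrite (integrable_mkcond _ mB); congr (integrable _ _ _).
apply/funext => x; rewrite /patch/=; case: ifPn => //.
rewrite notin_setE /cball/= => /negP; rewrite -ltNge => /f0.
by move=> ->.
Qed.

Lemma partial_near_eq0 f i x : (\forall y \near x, f y = 0) -> partial i f x = 0.
Proof.
by move=> f0; rewrite /partial (@near_eq_derive _ _ _ f (cst 0)) ?derive_cst.
Qed.

Lemma partial_eq0 f M i x : (forall x, M < enorm x -> f x = 0) -> M < enorm x ->
  partial i f x = 0.
Proof.
move=> f0 Mx; apply: partial_near_eq0.
have o : open [set y : 'rV[R]_N | M < enorm y].
  apply: (@open_comp _ _ (@enorm R N) [set r | M < r]); last exact: open_gt.
  by move=> y _; exact: enorm_continuous.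
apply: filterS (open_nbhs_nbhs (conj o Mx)) => y; exact: f0.
Qed.

Lemma gradient_notin_supp f x : ~ supp f x -> gradient f x = 0.
Proof.
move=> xf; apply/rowP => i; rewrite !mxE; apply: partial_near_eq0.
have o : open (~` supp f) by apply: closed_openC; exact: closed_closure.
apply: filterS (open_nbhs_nbhs (conj o xf)) => y; apply: contra_notP => /eqP.
exact: (@subset_closure _ [set z | f z != 0] y).
Qed.

(* Translation invariance makes the integrals of the difference quotients vanish,
   and dominated convergence passes to the limit. *)
Lemma integral_partial_eq0 (w : 'rV[R]_N -> R) M i :
  continuous w -> (forall x, derivable w x 'e_i) -> continuous (partial i w) ->
  (forall x, M < enorm x -> w x = 0) ->
  (\int[mu]_x (partial i w x)%:E = 0)%E.
Proof.
move=> cw dw cdw w0'.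
(* M1 dominates both M and the shifts h n <= 1, so that by [enormD_le] all difference quotients
   vanish for |x| > 2 M1. *)
pose M1 := Num.max M 1.
have M11 : 1 <= M1 by rewrite le_max lexx orbT.
have w0 x : M1 < enorm x -> w x = 0.
  by rewrite gt_max => /andP[+ _]; exact: w0'.
have dw0 x : M1 < enorm x -> partial i w x = 0 by exact: partial_eq0.
have [C C0 Cdw'] := compact_bounded_image (continuous_subspaceT cdw) (@compact_euclidean_ball M1).
have Cdw x : `|partial i w x| <= C.
  have [xM|Mx] := leP (enorm x) M1; first exact: Cdw'.
  by rewrite dw0// normr0.
pose h (n : nat) : R := n.+1%:R^-1.
have h0 n : 0 < h n by rewrite invr_gt0.
have h1 n : h n <= 1 by rewrite invf_le1// ler1n.
pose f n (x : @RN R N) := (h n)^-1 * (w (translate (h n *: 'e_i) x) - w x).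
(* The mean value theorem along the segment from x to x + h e_i gives a bound uniform in n. *)
have fC n x : `|f n x| <= C.
  pose l (t : R) := w (t *: 'e_i + x).
  have dl (t : R) : is_derive t 1 l (partial i w (t *: 'e_i + x)).
    apply: (is_derive_line w x 'e_i t (partial i w (t *: 'e_i + x))).1.
    by apply: DeriveDef; [exact: dw|].
  have cl : {within `[0, h n], continuous l}.
    apply: derivable_within_continuous => t _; by case: (dl t).
  have [t _] := @MVT _ l _ _ _ (h0 n) (fun t _ => dl t) cl.
  rewrite /l scale0r add0r subr0 /f /translate [x + _]addrC => ->.
  by rewrite mulrCA mulVf ?mulr1// gt_eqF.
have tM0 n x : 2 * M1 < enorm x -> M1 < enorm (translate (h n *: 'e_i) x).
  move=> xM; rewrite ltNge; apply/negP => tM.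
  have : enorm x <= 2 * M1.
    rewrite -[x](addrK (h n *: 'e_i)).
    apply: (le_trans (enormD_le _ _)); apply: ler_wpM2l => //.
    rewrite ge_max tM -scaleNr enormZ enorm_e mulr1 normrN gtr0_norm//.
    exact: le_trans (h1 n) M11.
  by rewrite leNgt xM.
have f0 n x : 2 * M1 < enorm x -> f n x = 0.
  move=> xM; have xM1 : M1 < enorm x by apply: le_lt_trans xM; lra.
  by rewrite /f (w0 x)// (w0 _ (tM0 n x xM)) subrr mulr0.
have ct n : continuous (w \o translate (h n *: 'e_i)).
  move=> x; apply: continuous_comp; last exact: cw.
  exact: (cvgD (@cvg_id _ (nbhs x)) (cvg_cst _)).
have cf n : continuous (f n).
  move=> x; exact: (cvgM (@cst_continuous _ _ (h n)^-1 x) (cvgB (ct n x) (cw x))).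
have intw : mu.-integrable setT (EFin \o w) by exact: integrable_bounded_support w0.
have intwt n : mu.-integrable setT (EFin \o w \o translate (h n *: 'e_i)).
  apply: (@integrable_bounded_support (w \o translate (h n *: 'e_i)) (2 * M1)).
    exact: ct.
  by move=> x /(tM0 n) /w0.
have If n : (\int[mu]_x (f n x)%:E = 0)%E.
  have mw : measurable_fun [set: @RN R N] w by exact: continuous_measurable_RN.
  transitivity ((h n)^-1%:E * (\int[mu]_x (w (translate (h n *: 'e_i) x))%:E
      - \int[mu]_x (w x)%:E))%E.
    rewrite -(integralB_EFin measurableT (intwt n) intw).
    rewrite -(integralZl measurableT (integrableB measurableT (intwt n) intw)).
    by apply: eq_integral.
  rewrite (integral_translate mw (intwt n)) subee ?mule0//.
  exact: (integrable_fin_num _ intw).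
have cvf x : (f n x)%:E @[n --> \oo] --> (partial i w x)%:E.
  apply: cvg_EFin; first by near=> n.
  have hh : h n @[n --> \oo] --> (0 : R)^'.
    move=> P; rewrite /dnbhs /within/= => /cvg_harmonic nP.
    have {}nP : \forall n \near \oo, h n != 0 -> P (h n) by exact: nP.
    suff : \forall n \near \oo, P (h n) by [].
    by apply: filterS nP => n /=; apply; rewrite gt_eqF ?h0.
  have dq : t^-1 *: ((w \o shift x) (t *: 'e_i) - w x) @[t --> 0^'] --> partial i w x.
    exact: dw.
  have := @cvg_comp _ _ _ _ _ _ _ _ hh dq.
  apply: cvg_trans; apply: near_eq_cvg; near=> n.
  by rewrite /f /translate /= [x + _]addrC.
have mf n : measurable_fun [set: @RN R N] (EFin \o f n).
  exact/measurable_EFinP/continuous_measurable_RN.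
have mdw : measurable_fun [set: @RN R N] (EFin \o partial i w).
  exact/measurable_EFinP/continuous_measurable_RN.
have mB : measurable (cball (2 * M1) : set (@RN R N)) by exact: measurable_cball.
pose g : @RN R N -> \bar R := (EFin \o cst C) \_ (cball (2 * M1)).
have ig : mu.-integrable setT g.
  rewrite -(integrable_mkcond _ mB).
  exact: integrable_compact (@cst_continuous _ _ C) (@compact_euclidean_ball (2 * M1)).
have fg n x : (`|(EFin \o f n) x| <= g x)%E.
  rewrite /g /patch/=; case: ifPn => [_|]; first by rewrite lee_fin.
  rewrite notin_setE /cball/= => /negP; rewrite -ltNge => /f0 ->.
  by rewrite normr0.
have [_ _] := @dominated_convergence _ _ _ mu setT measurableT (fun n => EFin \o f n)
  (EFin \o partial i w) _ mf mdw (aeW _ (fun x _ => cvf x)) ig (aeW _ (fun x n _ => fg n x)).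
under eq_fun do rewrite If.
move=> H; apply/esym; apply: (cvg_unique _ _ H) => //.
exact: cvg_cst.
Unshelve. all: by end_near. Qed.

(** Integration by parts: the partial derivatives of u phi have integral 0, phi supplying the
    bounded support. *)
Lemma weak_gradient_smooth u : smooth u ->
  is_weak_gradient punctured u (gradient u).
Proof.
move=> su; have cu := smooth_continuous su.
have cdu i : continuous (partial i u) by exact: smooth_partial_continuous.
split.
- by move=> C cC _; exact: integrable_compact.
- move=> i C cC _; have -> : (fun x => (gradient u x 0 i)%:E) = EFin \o partial i u.
    by apply/funext => x; rewrite mxE.
  exact: integrable_compact.
move=> phi Cphi i.
have sphi : smooth phi by case: Cphi.
have cphi := smooth_continuous sphi.
have cdphi : continuous (partial i phi) by exact: smooth_partial_continuous.
have Cphi' : Cc_infty setT phi by case: Cphi => ? ? _; split.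
have [M M0 phi0] := Cc_bounded_support i Cphi'.
under [in RHS]eq_integral do rewrite mxE.
pose w x := u x * phi x.
have dw x : is_derive x 'e_i w (u x * partial i phi x + phi x * partial i u x).
  by apply: is_deriveM; apply/derivableP; exact: smooth_derivable.
have dwE : partial i w = (fun x => u x * partial i phi x + partial i u x * phi x).
  by apply/funext => x; rewrite /partial; case: (dw x) => _ ->; rewrite [X in _ + X]mulrC.
have c1 : continuous (fun x => u x * partial i phi x).
  by move=> x; exact: (cvgM (cu x) (cdphi x)).
have c2 : continuous (fun x => partial i u x * phi x).
  by move=> x; exact: (cvgM (cdu i x) (cphi x)).
have i1 : mu.-integrable setT (EFin \o (fun x => u x * partial i phi x)).
  apply: (@integrable_bounded_support _ M) => // x Mx.
  by rewrite (partial_eq0 _ phi0)// mulr0.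
have i2 : mu.-integrable setT (EFin \o (fun x => partial i u x * phi x)).
  by apply: (@integrable_bounded_support _ M) => // x /phi0 ->; rewrite mulr0.
have := @integral_partial_eq0 w M i.
rewrite dwE => /(_ _ _ _ _) I0.
have {I0} : (\int[mu]_x (u x * partial i phi x + partial i u x * phi x)%:E = 0)%E.
  apply: I0.
  - by move=> x; exact: (cvgM (cu x) (cphi x)).
  - by move=> x; case: (dw x).
  - by move=> x; exact: (cvgD (c1 x) (c2 x)).
  - by move=> x /phi0 px; rewrite /w px mulr0.
rewrite integralD_EFin//.
rewrite -(fineK (integrable_fin_num measurableT i1)) -(fineK (integrable_fin_num measurableT i2)).
by rewrite -EFinD -EFinN => -[/eqP]; rewrite addr_eq0 => /eqP ->.
Qed.

End bounded_support.

(** * A normalised element of X *)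

Section competitor.
Context {R : realType} {N : nat}.
Variable i0 : 'I_N.
Let N0 : (0 < N)%N. Proof. by case: (N) (i0) => [[]|]. Qed.
Local Notation mu := (@lebesgueN R N).
Local Notation cara := (caratheodory_type ((wlength (@idfun R))^*)%mu).
Variables (p a0 aoo c0 coo : R) (A V : R -> R).
Hypotheses (p1 : 1 < p) (pNa0 : p - N%:R < a0) (pNaoo : p - N%:R < aoo).
Hypotheses (c0_gt0 : 0 < c0) (coo_gt0 : 0 < coo).
Hypothesis A_gt0 : forall r, 0 < r -> 0 < A r.
Hypothesis A_cont : forall r, 0 < r -> {for r, continuous A}.
Hypothesis A_low0 : forall r, 0 < r <= 1 -> c0 * r `^ a0 <= A r.
Hypothesis A_lowoo : forall r, 1 <= r -> coo * r `^ aoo <= A r.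
Hypothesis V_ge0 : forall r, 0 < r -> 0 <= V r.
Hypothesis V_loc : Lloc_pos 1 V.
Let p0 : 0 < p. Proof. exact: lt_trans p1. Qed.
Let mV : measurable_fun (`]0, +oo[ : set cara) V. Proof. by case: V_loc. Qed.

Lemma measurable_annulus (a b : R) : measurable (annulus a b : set (@RN R N)).
Proof. by apply: compact_measurable_RN; exact: compact_annulus. Qed.

Lemma measurable_fun_annulus d (T : measurableType d) (a b : R) (f : @RN R N -> T) :
  0 < a -> measurable_fun (punctured : set (@RN R N)) f ->
  measurable_fun (annulus a b : set (@RN R N)) f.
Proof.
move=> a_gt0; apply: measurable_funS; first exact: measurable_punctured.
exact: annulus_punctured.
Qed.

Lemma lebesgueN_annulus_lty (a b : R) : (mu (annulus a b) < +oo)%E.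
Proof.
apply: le_lt_trans (lebesgueN_cball_lty (Num.max b 0)).
apply: lebesgueN_le => x /andP[_]; rewrite /cball/= => xb.
by rewrite le_max xb.
Qed.

(** On an annulus A and the radial derivative are bounded by continuity, whereas A may blow up at
    the origin. *)
Lemma energy_lty (u : 'rV[R]_N -> R) (a b : R) : 0 < a ->
  smooth u -> radial u -> supp u `<=` annulus a b ->
  (energy p A (gradient u) < +oo)%E.
Proof.
move=> a_gt0 su ru sub.
pose G x : R := A (enorm x) * enorm (gradient u x) `^ p.
have mD := measurable_annulus a b.
have mG : measurable_fun (annulus a b : set (@RN R N)) (EFin \o G).
  apply: (measurable_fun_annulus a_gt0).
  exact: (measurable_energy_integrand p A_cont
    (fun i => measurable_funTS (measurable_gradient i su))).
have GE : EFin \o G = (EFin \o G) \_ (annulus a b).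
  apply/funext => x; rewrite /patch/=; case: ifPn => //.
  rewrite notin_setE => xab; rewrite /G gradient_notin_supp ?enorm0.
    by rewrite powR0 ?mulr0// gt_eqF.
  by move=> /sub.
have cab : compact `[a, b] by exact: segment_compact.
have [BA BA0 BAP] : exists2 B, 0 <= B & forall r, `[a, b]%classic r -> `|A r| <= B.
  apply: compact_bounded_image => //; apply: continuous_in_subspaceT => r.
  rewrite inE/= in_itv/= => /andP[ar _]; apply: A_cont.
  exact: lt_le_trans ar.
have [Bd Bd0 BdP] := compact_bounded_image
  (continuous_subspaceT (@dprofile_continuous _ _ i0 u su)) cab.
have bG x : annulus a b x -> (`|(G x)%:E| <= (BA * Bd `^ p)%:E)%E.
  move=> abx; have /andP[ax _] := abx.
  have x0 : 0 < enorm x by exact: lt_le_trans ax.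
  have itx : `[a, b]%classic (enorm x) by rewrite /= in_itv/= -/(annulus a b x).
  rewrite /G lee_fin normrM ler_pM// ?BAP// ger0_norm ?powR_ge0//.
  rewrite (enorm_gradient_radial (i0 := i0))//; last 2 first.
    by move=> r r0; exact: smooth_derivable.
    by rewrite -enorm_gt0.
  by apply: ge0_ler_powR; rewrite ?nnegrE ?(ltW p0)// BdP.
rewrite /energy -/G (_ : (fun x => _) = EFin \o G)// GE -integral_mkcond.
apply: (@le_lt_trans _ _ ((BA * Bd `^ p)%:E * mu (annulus a b))%E).
  have M0 : (0 <= (BA * Bd `^ p)%:E)%E by rewrite lee_fin mulr_ge0 ?powR_ge0.
  apply: (le_trans (lee_abs _)); apply: (le_trans (le_abse_integral mu mD mG)).
  apply: (@integral_le_bound _ (@RN R N) R mu (annulus a b) (EFin \o G) _ mD mG M0).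
  exact: aeW.
rewrite lte_mul_pinfty ?lee_fin ?mulr_ge0 ?powR_ge0//.
exact: lebesgueN_annulus_lty.
Qed.

(** V may be unbounded on the annulus, so only |u|^p is bounded and V is integrated over the radii
    by [integral_comp_enorm_le]. *)
Lemma potential_lty (u : 'rV[R]_N -> R) (a b : R) : 0 < a <= b ->
  continuous u -> supp u `<=` annulus a b -> (potential p V u < +oo)%E.
Proof.
move=> /andP[a_gt0 ab] cu sub.
have [B B0 BP] := compact_bounded_image (continuous_subspaceT cu)
  (@compact_annulus R N a b).
have mD := measurable_annulus a b.
have mVe : measurable_fun (annulus a b : set (@RN R N)) (fun x => (V (enorm x))%:E).
  apply/measurable_EFinP.
  apply: (measurable_fun_annulus a_gt0).
  exact: (@measurable_cara_comp_enorm _ _ N0 V).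
have V0 x : annulus a b x -> 0 <= V (enorm x).
  by move=> /andP[ax _]; apply: V_ge0; exact: lt_le_trans ax.
pose G x : R := V (enorm x) * `|u x| `^ p.
have mG : measurable_fun (annulus a b : set (@RN R N)) (EFin \o G).
  apply: (measurable_fun_annulus a_gt0).
  apply: (measurable_weighted i0 p mV).
  exact/measurable_funTS/continuous_measurable_RN.
have GE : EFin \o G = (EFin \o G) \_ (annulus a b).
  apply/funext => x; rewrite /patch/=; case: ifPn => //.
  rewrite notin_setE => xab; rewrite /G (_ : u x = 0).
    by rewrite normr0 powR0 ?mulr0// gt_eqF.
  apply/eqP/negPn/negP => ux; apply/xab/sub.
  exact: (@subset_closure _ [set z | u z != 0] x).
rewrite /potential (_ : (fun x => _) = EFin \o G)// GE -integral_mkcond.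
apply: (@le_lt_trans _ _ (\int[mu]_(x in annulus a b) ((B `^ p)%:E * (V (enorm x))%:E)))%E.
  apply: ge0_le_integral.
  - exact: mD.
  - by move=> x abx; rewrite lee_fin mulr_ge0 ?powR_ge0// V0.
  - exact: mG.
  - exact: measurable_funeM.
  - move=> x abx; rewrite lee_fin /G mulrC ler_wpM2r ?V0//.
    by apply: ge0_ler_powR; rewrite ?nnegrE ?(ltW p0)// BP.
rewrite (ge0_integralZl _ mD mVe); last 2 first.
  by move=> x abx; rewrite lee_fin V0.
  by rewrite lee_fin powR_ge0.
rewrite lte_mul_pinfty ?lee_fin ?powR_ge0//.
have abh : 0 < a <= b by rewrite a_gt0.
apply: (le_lt_trans (integral_comp_enorm_le N0 abh V_ge0 mV)).
rewrite lte_mul_pinfty ?lee_fin ?shell_cst_ge0 ?(le_trans (ltW a_gt0))//.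
have [_ /(_ `[a, b]%classic)] := V_loc.
have D0 : `[a, b] `<=` `]0, +oo[.
  by move=> r; rewrite /= !in_itv/= andbT => /andP[ar _]; exact: lt_le_trans ar.
move=> /(_ (@segment_compact _ _ _) D0); congr (_ < _)%E.
apply: eq_integral => r; rewrite inE => /D0; rewrite /= in_itv/= andbT => r0.
by rewrite powRr1 ?normr_ge0// ger0_norm// V_ge0.
Qed.

Lemma gradientZ (c : R) (u : 'rV[R]_N -> R) : smooth u ->
  gradient (fun x => c * u x) = (fun x => c *: gradient u x).
Proof.
move=> su; apply/funext => x; apply/rowP => i; rewrite !mxE /partial.
have du : derivable u x 'e_i by exact: smooth_derivable.
exact: (deriveZ c du).
Qed.

Lemma energyZ (c : R) (g : 'rV[R]_N -> 'rV[R]_N) :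
  (forall i, measurable_fun (punctured : set (@RN R N)) (fun x => g x 0 i)) ->
  energy p A (fun x => c *: g x) = ((`|c| `^ p)%:E * energy p A g)%E.
Proof.
move=> mg; rewrite /energy.
have m1 := measurable_energy_integrand p A_cont mg.
have m2 : measurable_fun (punctured : set (@RN R N))
    (fun x => (`|c| `^ p)%:E * (A (enorm x) * enorm (g x) `^ p)%:E)%E.
  exact: measurable_funeM.
have E x : ((A (enorm x) * enorm (c *: g x) `^ p)%:E =
    (`|c| `^ p)%:E * (A (enorm x) * enorm (g x) `^ p)%:E)%E.
  by rewrite enormZ powRM ?enorm_ge0// -EFinM mulrCA.
under eq_integral do rewrite E.
rewrite (integral_punctured N0 m1) (integral_punctured N0 m2).
apply: (ge0_integralZl _ (@measurable_punctured R N) m1).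
  move=> x; rewrite punctured_enorm => x0.
  by rewrite lee_fin mulr_ge0 ?powR_ge0// ltW// A_gt0.
by rewrite lee_fin powR_ge0.
Qed.

Lemma potentialZ (c : R) (u : 'rV[R]_N -> R) :
  measurable_fun (punctured : set (@RN R N)) u ->
  potential p V (fun x => c * u x) = ((`|c| `^ p)%:E * potential p V u)%E.
Proof.
move=> mu_; rewrite /potential.
have m1 := measurable_weighted i0 p mV mu_.
have m2 : measurable_fun (punctured : set (@RN R N))
    (fun x => (`|c| `^ p)%:E * (V (enorm x) * `|u x| `^ p)%:E)%E.
  exact: measurable_funeM.
have E x : ((V (enorm x) * `|(c * u x)%R| `^ p)%:E =
    (`|c| `^ p)%:E * (V (enorm x) * `|u x| `^ p)%:E)%E.
  by rewrite normrM powRM ?normr_ge0// -EFinM mulrCA.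
under eq_integral do rewrite E.
rewrite (integral_punctured N0 m1) (integral_punctured N0 m2).
apply: (ge0_integralZl _ (@measurable_punctured R N) m1).
  move=> x; rewrite punctured_enorm => x0.
  by rewrite lee_fin mulr_ge0 ?powR_ge0// V_ge0.
by rewrite lee_fin powR_ge0.
Qed.

(** The constant sequence approximates u. *)
Lemma D_A_S_A (u : 'rV[R]_N -> R) : S_A p A u -> D_A p A u (gradient u).
Proof.
move=> Su; have [[su _ _] ru _] := Su.
split; [exact: ru|exact: weak_gradient_smooth|exists (fun=> u)].
split; first by move=> _.
  rewrite (_ : energy _ _ _ = 0%E); first exact: cvg_cst.
  rewrite /energy; apply: integral0_eq => x _.
  by rewrite subrr enorm0 powR0 ?mulr0// gt_eqF.
by apply: aeW => x; exact: cvg_cst.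
Qed.

Let smooth_bump c : smooth (@annular_bump R N c).
Proof. by case: (@Cc_infty_bump R N c). Qed.

Lemma S_A_bump c : S_A p A (@annular_bump R N c).
Proof.
split; first exact: Cc_infty_bump.
  exact: radial_bump.
apply: (@energy_lty _ 2^-1 1) => //.
  exact: radial_bump.
exact: supp_bump.
Qed.

Let bumpE c : @annular_bump R N c = (fun x => c * annular_bump 1 x).
Proof. by apply/funext => x; exact: bumpZ. Qed.

Let mgradient_bump i :
  measurable_fun (punctured : set (@RN R N)) (fun x => gradient (annular_bump 1) x 0 i).
Proof. exact/measurable_funTS/measurable_gradient. Qed.

Lemma energy_bump_gt0 : (0 < energy p A (gradient (@annular_bump R N 1)))%E.
Proof.
rewrite lt0e (energy_ge0 i0 p A_gt0 A_cont mgradient_bump) andbT.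
apply/eqP => E0.
(* A point where the bump is positive and the decay bound, valid for |x| <= 1, applies. *)
pose x := @ray R N i0 (3 / 4).
have ex : enorm x = 3 / 4 by rewrite enorm_ray//; lra.
have bx : 0 < annular_bump 1 x by apply: bump1_gt0; rewrite ex; apply/andP; split; lra.
pose B := enorm x `^ (- @decay R N p a0) * @bound_cst R N p a0 aoo c0 coo 0.
have cB c : c * annular_bump 1 x <= B.
  rewrite -bumpZ; apply: (le_trans (ler_norm _)).
  apply: (S_A_bound i0 p1 pNa0 pNaoo c0_gt0 coo_gt0 A_gt0 A_cont A_low0 A_lowoo
    (S_A_bump c)).
    by rewrite bumpE gradientZ// energyZ// E0 mule0.
  by rewrite ex; apply/andP; split; lra.
have := cB ((B + 1) / annular_bump 1 x); rewrite mulfVK ?gt_eqF//.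
by rewrite gerDl ler10.
Qed.

Lemma X_unit_nonempty : exists (u : 'rV[R]_N -> R) g, X p A V u g /\ X_norm p A V u g = 1%E.
Proof.
have mb : measurable_fun (punctured : set (@RN R N)) (@annular_bump R N 1).
  exact/measurable_funTS/continuous_measurable_RN/smooth_continuous.
have Eoo : (energy p A (gradient (@annular_bump R N 1)) < +oo)%E by case: (S_A_bump 1).
have cb c : continuous (@annular_bump R N c) by exact: smooth_continuous.
have h1 : 0 < (2^-1 : R) <= 1 by rewrite invr_gt0 invf_le1// ltr0n ler1n.
have Poo c : (potential p V (@annular_bump R N c) < +oo)%E.
  exact: (potential_lty h1 (cb c) (@supp_bump R N c)).
have P0 : (0 <= potential p V (@annular_bump R N 1))%E.
  rewrite (potentialE i0 p mV mb); apply: integral_ge0 => x.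
  rewrite punctured_enorm => x0.
  by rewrite lee_fin mulr_ge0 ?powR_ge0// V_ge0.
pose T := (energy p A (gradient (@annular_bump R N 1)) + potential p V (@annular_bump R N 1))%E.
have T0 : (0 < T)%E by exact: lt_le_trans energy_bump_gt0 (leeDl _ P0).
have Tfin : T \is a fin_num by rewrite (ge0_fin_numE (ltW T0)); exact: lte_add_pinfty Eoo (Poo 1).
pose t := fine T; have t0 : 0 < t by apply: fine_gt0; rewrite T0 -(ge0_fin_numE (ltW T0)).
(* Energy and potential are homogeneous of degree p, and c^p t = 1. *)
pose c := t `^ (- p^-1).
exists (annular_bump c), (gradient (annular_bump c)); split.
  split; last exact: Poo.
  exact/D_A_S_A/S_A_bump.
rewrite /X_norm bumpE (gradientZ _ (smooth_bump 1)) (energyZ _ mgradient_bump) (potentialZ _ mb).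
rewrite -(ge0_muleDr _ (ltW energy_bump_gt0) P0).
rewrite -/T -(fineK Tfin) -/t -EFinM poweR_EFin ger0_norm ?powR_ge0//.
rewrite -powRrM mulNr mulVf ?gt_eqF// powRN powRr1 ?(ltW t0)//.
by rewrite mulVf ?gt_eqF// powR1.
Qed.

Lemma S_0_ge0 (K : R -> R) (q rho : R) : (forall r, 0 < r -> 0 < K r) ->
  measurable_fun (`]0, +oo[ : set cara) K -> (0 <= @S_0 R N p A V K q rho)%E.
Proof.
move=> K_gt0 mK; have [u [g [Xu n1]]] := X_unit_nonempty.
apply: (@le_trans _ _
  (\int[mu]_(x in eball rho) (K (enorm x) * `|u x| `^ q)%:E)%E); last first.
  by apply: ereal_sup_ubound; exists (u, g).
have mu_ : measurable_fun (punctured : set (@RN R N)) u.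
  by case: Xu => -[_ [lu _ _] _] _; exact: L1loc_measurable.
have mKu := measurable_weighted i0 q mK mu_.
rewrite (integral_eball_punctured i0 rho mKu).
apply: integral_ge0 => x [+ _]; rewrite punctured_enorm => x0.
by rewrite lee_fin mulr_ge0 ?powR_ge0// ltW// K_gt0.
Qed.

End competitor.

Theorem theorem3p2 (R : realType) (N : nat) (p : R) (A V K : R -> R)
    (a0 aoo c0 coo : R)
    (hN : (3 <= N)%N) (hp : 1 < p < N%:R)
    (hA : hyp_A N p A a0 aoo c0 coo) (hV : hyp_V V) (hK : hyp_K K)
    (R1 alpha0 beta0 : R) (hR1 : 0 < R1)
    (hVfin : {ae @completed_lebesgue_measure R,
                forall r, 0 < r < R1 -> ((V r)%:E < +oo)%E})
    (hbeta0 : 0 <= beta0 <= 1) (halpha0 : alpha_star N p a0 beta0 < alpha0)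
    (hess : (ess_sup (@completed_lebesgue_measure R)
               (KV_ratio K V alpha0 beta0 \_ `]0, R1[)%R < +oo)%E)
    (q1 : R) (hq1 : Num.max 1 (p * beta0) < q1)
    (hq1' : q1 < q_star N p a0 alpha0 beta0) :
  @S_0 R N p A V K q1 rho @[rho --> 0^'+] --> 0%E.
Proof.
have /andP[p1 pN] := hp.
(* Any coordinate axis serves to define the profiles of radial functions. *)
have i0 : 'I_N by exists 0%N; exact: leq_trans hN.
case: hA => hA1 [/andP[pNa0 _] /andP[pNaoo _]] [c0_gt0 coo_gt0] [A0 _ _] [Aoo _ _].
have A_gt0 (r : R) : 0 < r -> 0 < A r by move=> /hA1[].
have A_cont (r : R) : 0 < r -> {for r, continuous A} by move=> /hA1[].
have [d0 d0_gt0 A_low0] := near0_lower c0_gt0 A_gt0 A_cont A0.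
have [doo doo_gt0 A_lowoo] := nearoo_lower coo_gt0 A_gt0 A_cont Aoo.
have [V_ge0 V_loc] := hV; have [mV _] := V_loc.
have [K_gt0 [s _ [mK _]]] := hK.
(* The estimates multiply by [Lam], so a real essential supremum is replaced by its maximum with
   0. *)
have [Lam Lam0 essL] : exists2 Lam : R, 0 <= Lam &
    (ess_sup (@completed_lebesgue_measure R)
      (KV_ratio K V alpha0 beta0 \_ `]0%R, R1[) <= Lam%:E)%E.
  case: (ess_sup _ _) hess => [r _|//|_].
    by exists (Num.max r 0); rewrite ?lee_fin le_max lexx ?orbT.
  by exists 0 => //; exact: leNye.
have KV : {ae @completed_lebesgue_measure R, forall r, 0 < r < R1 ->
    (KV_ratio K V alpha0 beta0 r <= Lam%:E)%E}.
  move/ess_supP: essL; apply: negligibleS => r /=; apply: contra_not => h rR.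
  by move: h; rewrite /patch mem_set//= in_itv.
move: hq1; rewrite gt_max => /andP[q1_gt1 pbq].
have [C [delta [C0 delta0 S_le]]] := S_0_le i0 p1 pNa0 pNaoo d0_gt0 doo_gt0
  A_gt0 A_cont A_low0 A_lowoo V_ge0 mV K_gt0 mK hbeta0 Lam0 KV q1_gt1 pbq hq1'.
apply: (@squeeze_cvge _ _ _ _ (fun=> 0%E) _ (fun rho => (C * rho `^ delta)%:E)).
- near=> rho; rewrite (S_0_ge0 i0 p1 pNa0 pNaoo d0_gt0 doo_gt0 A_gt0 A_cont A_low0
    A_lowoo V_ge0 V_loc)//=.
  apply: S_le; first apply/andP; first split.
  - by near: rho; exact: nbhs_right_gt.
  - by near: rho; exact: nbhs_right_le.
  - by near: rho; exact: nbhs_right_le.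
- exact: cvg_cst.
- apply: cvg_EFin; first by near=> rho.
  rewrite -[X in _ --> X](mulr0 C); apply: cvgM; first exact: cvg_cst.
  exact: powR_cvg0.
Unshelve. all: by end_near. Qed.
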